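(* Let $\{x^k\}_{k\ge1}$ be generated by the block stochastic gradient (BSG) method (described in the context) with stepsizes $\alpha_i^k=\alpha_k=\frac{\theta}{\sqrt k}<\frac1L$ for all $i,k$, for some positive constant $\theta<\frac1L$. Assume: (1) there are a constant $A$ and a sequence $\{\sigma_k\}$ such that for all $i,k$: $\big\|\mathbb E[\delta_i^k\mid\mathbf\Xi_{[k-1]}]\big\|\le A\max_j\alpha_j^k$ and $\mathbb E\|\delta_i^k\|^2\le\sigma_k^2$; (2) $\Phi$ is bounded below, and $L>0$ is such that $\|\nabla_{x_i}F(x)-\nabla_{x_i}F(y)\|\le L\|x-y\|$ for all $x,y$ and all $i$; (3) there is a constant $\rho$ such that $\mathbb E\|x^k\|^2\le\rho^2$ for all $k$; (4) every $r_i$ is Lipschitz continuous with constant $L_{r_i}$, i.e. $|r_i(x_i)-r_i(y_i)|\le L_{r_i}\|x_i-y_i\|$ for all $x_i,y_i$; put $L_{\max}=\max_iL_{r_i}$. If $F$ and all $r_i$ are convex, $x^*$ is a solution of the problem $\min_{x\in\mathcal X}\Phi(x)$, and $\sigma:=\sup_k\sigma_k<\infty$, then $$\mathbb E[\Phi(\tilde x^K)-\Phi(x^* )]\le D\theta\,\frac{1+\log K}{\sqrt{1+K}}+\frac{\|x^*-x^1\|^2}{2\theta\sqrt{1+K}},$$ where $\tilde x^K=\dfrac{\sum_{k=1}^K\alpha_kx^{k+1}}{\sum_{k=1}^K\alpha_k}$, $$D=\frac{s(\sigma^2+4L_{\max}^2)}{1-L\theta}+\sqrt s\,(\|x^*\|+\rho)\left(A+L\sqrt{\sum_{j=1}^s(4M_\rho^2+4\sigma^2+2L_{r_j}^2)}\right),$$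 and $M_\rho=\sqrt{4L^2\rho^2+2\max_i\|\nabla_{x_i}F(0)\|^2}$. Furthermore, if the maximum number of iterations $K$ is predetermined, then taking instead $\alpha_i^k=\alpha_k=\frac{\theta}{\sqrt K}$ for all $i,k$, one has $$\mathbb E[\Phi(\tilde x^K)-\Phi(x^* )]\le\frac{D\theta}{\sqrt K}+\frac{\|x^*-x^1\|^2}{2\theta\sqrt K}.$$
   Context: Problem. Minimize $\Phi(x)=F(x)+\sum_{i=1}^sr_i(x_i)$ with $F(x)=\mathbb E_\xi f(x;\xi)$, subject to $x_i\in\mathcal X_i$, $i=1,\dots,s$. Here $\xi$ is a random variable, $x=(x_1,\dots,x_s)\in\mathbb R^n$ is partitioned into blocks $x_i\in\mathbb R^{n_i}$, $\mathcal X_i\subset\mathbb R^{n_i}$ are convex, $\mathcal X=\mathcal X_1\times\dots\times\mathcal X_s$, $F$ is continuously differentiable, and $r_i$ are (possibly non-differentiable) regularization functions on $\mathbb R^{n_i}$. $\|\cdot\|$ is the Euclidean norm, $x_{<i}=(x_1,\dots,x_{i-1})$, and similarly $x_{\ge i}$; $\nabla_{x_i}$ is the partial gradient in block $i$. BSG method. Given a starting point $x^1$, stepsizes $\alpha_i^k>0$, and positive integers $m_k$: at iteration $k=1,2,\dots$ draw a random mini-batch $\Xi_k=\{\xi_{k,1},\dots,\xi_{k,m_k}\}$ of samples of $\xi$; then for $i=1,\dots,s$ in this order compute $$\tilde g_i^k=\frac1{m_k}\sum_{\ell=1}^{m_k}\nabla_{x_i}f(x_{<i}^{k+1},x_{\ge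 i}^k;\xi_{k,\ell})$$ and update block $i$: if $\mathcal X_i=\mathbb R^{n_i}$, $$x_i^{k+1}=\arg\min_{x_i}\ \langle\tilde g_i^k,x_i-x_i^k\rangle+\tfrac1{2\alpha_i^k}\|x_i-x_i^k\|^2+r_i(x_i);$$ otherwise, $$x_i^{k+1}=\arg\min_{x_i\in\mathcal X_i}\ \langle\tilde g_i^k+\tilde\nabla r_i(x_i^k),x_i-x_i^k\rangle+\tfrac1{2\alpha_i^k}\|x_i-x_i^k\|^2,$$ where $\tilde\nabla r_i(x_i^k)$ is a subgradient of $r_i$ at $x_i^k$ (assumed to exist). Both subproblems are assumed to be solvable. Notation: $g_i^k=\nabla_{x_i}F(x_{<i}^{k+1},x_{\ge i}^k)$, $\delta_i^k=\tilde g_i^k-g_i^k$, $\mathbf\Xi_{[k]}=(\Xi_1,\dots,\Xi_k)$; $\mathbb E[\cdot\mid\cdot]$ is conditional expectation. *)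

(* Defs.v *)
(* A point of R^n partitioned into s blocks of sizes n i is
   a row vector of size \sum_(i < s) n i; its i-th block is submxrow x i. *)
From HB Require Import structures.
From mathcomp Require Import all_boot all_order all_algebra.
From mathcomp Require Import all_classical all_reals all_analysis.

Set Implicit Arguments.
Unset Strict Implicit.
Unset Printing Implicit Defensive.

Import Order.TTheory GRing.Theory Num.Theory.
Import numFieldNormedType.Exports.

Local Open Scope classical_set_scope.
Local Open Scope ring_scope.

Section Euclidean.
Context {R : realType}.

Definition dotv {n : nat} (u v : 'rV[R]_n) : R := \sum_(j < n) u 0 j * v 0 j.

(* The library's norm on row vectors is the max norm; it induces the same
   topology and hence the same notions of continuity and differentiability. *)
Definition enorm {n : nat} (u : 'rV[R]_n) : R := Num.sqrt (dotv u u).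

Definition grad {n : nat} (F : 'rV[R]_n -> R) (x : 'rV[R]_n) : 'rV[R]_n :=
  \row_(j < n) 'D_(delta_mx 0 j) F x.

Definition cont_differentiable {n : nat} (F : 'rV[R]_n -> R) : Prop :=
  (forall x, differentiable F x) /\ continuous (grad F).

Definition subgradient {n : nat} (h : 'rV[R]_n -> R) (x v : 'rV[R]_n) : Prop :=
  forall y, h x + dotv v (y - x) <= h y.

Definition is_argmin {V : Type} (C : set V) (h : V -> R) (x : V) : Prop :=
  C x /\ forall y, C y -> h x <= h y.

End Euclidean.

Section Blocks.
Context {R : realType} {s : nat} {n : 'I_s -> nat}.
Local Notation point := 'rV[R]_(\sum_(i < s) n i).

Definition pgrad (F : point -> R) (i : 'I_s) (x : point) : 'rV[R]_(n i) :=
  submxrow (grad F x) i.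

Definition gs_point (xnew xold : point) (i : 'I_s) : point :=
  \mxrow_(j < s) (if (j < i)%N then submxrow xnew j else submxrow xold j).

Definition feasible (X : forall i, set 'rV[R]_(n i)) : set point :=
  [set x | forall i, X i (submxrow x i)].

Definition composite (F : point -> R) (r : forall i, 'rV[R]_(n i) -> R)
    (x : point) : R :=
  F x + \sum_(i < s) r i (submxrow x i).

End Blocks.

Section Probability.
Context {R : realType} {d : measure_display} {T : measurableType d}.
Variable P : probability T R.

Definition exp_obj {V : Type} {d' : measure_display} {S : measurableType d'}
    (f : V -> S -> R) (xi : T -> S) (x : V) : R :=
  fine ('E_P[fun w => f x (xi w)]).

(* Y is a version of the conditional expectation of Z given <<s G >>. *)
Definition is_cond_exp (G : set (set T)) (Z Y : T -> R) : Prop :=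
  [/\ P.-integrable [set: T] (EFin \o Z),
      measurable_fun [set: g_sigma_algebraType G]
        (Y : g_sigma_algebraType G -> R),
      P.-integrable [set: T] (EFin \o Y) &
      forall B, <<s G >> B ->
        (\int[P]_(w in B) (Y w)%:E = \int[P]_(w in B) (Z w)%:E)%E].

Definition is_cond_exp_vec {n : nat} (G : set (set T)) (Z Y : T -> 'rV[R]_n) :
    Prop :=
  forall j, is_cond_exp G (fun w => Z w 0 j) (fun w => Y w 0 j).

End Probability.

(* Throughout, iters is the set of indices of the iterations that are performed:
   all k >= 1 for an infinite run, 1 <= k <= K for a run stopped after K
   iterations.  The iterates of the run are then x 1 and x k.+1 for k in iters.
   The mini-batch of iteration k is xi k 0, ..., xi k (m k - 1). *)
Section BSG.
Context {R : realType} {d d' : measure_display}.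
Context {T : measurableType d} {S : measurableType d'}.
Variable P : probability T R.
Context {s : nat} {n : 'I_s -> nat}.
Local Notation point := 'rV[R]_(\sum_(i < s) n i).
Variables (f : point -> S -> R) (xi0 : {RV P >-> S}).
Variables (r : forall i, 'rV[R]_(n i) -> R) (X : forall i, set 'rV[R]_(n i)).
Variables (m : nat -> nat) (xi : nat -> nat -> {RV P >-> S}).
Variables (iters : set nat) (alpha : 'I_s -> nat -> R) (x : nat -> T -> point).

(* generates the sigma-algebra of the mini-batches of iterations 1, ..., k *)
Definition batch_events (k : nat) : set (set T) :=
  [set A | exists j l B, [/\ (1 <= j <= k)%N, (l < m j)%N, measurable B &
                             A = xi j l @^-1` B]].

Definition stoch_grad (k : nat) (i : 'I_s) (w : T) : 'rV[R]_(n i) :=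
  (m k)%:R^-1 *:
    \sum_(l < m k) pgrad (f ^~ (xi k l w)) i (gs_point (x k.+1 w) (x k w) i).

Definition full_grad (k : nat) (i : 'I_s) (w : T) : 'rV[R]_(n i) :=
  pgrad (exp_obj P f xi0) i (gs_point (x k.+1 w) (x k w) i).

Definition grad_error (k : nat) (i : 'I_s) (w : T) : 'rV[R]_(n i) :=
  stoch_grad k i w - full_grad k i w.

Definition block_update (k : nat) (i : 'I_s) (w : T) : Prop :=
  let u_old := submxrow (x k w) i in
  let u_new := submxrow (x k.+1 w) i in
  let model (v u : 'rV[R]_(n i)) :=
    dotv v (u - u_old) + (2 * alpha i k)^-1 * enorm (u - u_old) ^+ 2 in
  (@X i = setT ->
     is_argmin setT (fun u => model (stoch_grad k i w) u + @r i u) u_new) /\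
  (@X i <> setT ->
     exists2 v, subgradient (@r i) u_old v &
       is_argmin (@X i) (model (stoch_grad k i w + v)) u_new).

(* The adaptedness clause records that the iterates are random vectors
   determined by the mini-batches drawn so far. *)
Definition bsg_run (x1 : point) : Prop :=
  [/\ forall w, x 1%N w = x1,
      forall k i w, iters k -> block_update k i w &
      forall k j, iters k ->
        measurable_fun [set: g_sigma_algebraType (batch_events k)]
          ((fun w => x k.+1 w 0 j) :
             g_sigma_algebraType (batch_events k) -> R)].

Definition grad_error_bound (A : R) (sigma : nat -> R) : Prop :=
  forall k i, iters k ->
    (exists2 Y : T -> 'rV[R]_(n i),
       is_cond_exp_vec P (batch_events k.-1) (grad_error k i) Y &
       {ae P, forall w, enorm (Y w) <= A * \big[Num.max/0]_(j < s) alpha j k}) /\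
    ('E_P[fun w => (enorm (grad_error k i w) ^+ 2)%R] <= (sigma k ^+ 2)%:E)%E.

Definition iterates_bound (rho : R) : Prop :=
  forall k, iters k ->
    ('E_P[fun w => (enorm (x k w) ^+ 2)%R] <= (rho ^+ 2)%:E)%E /\
    ('E_P[fun w => (enorm (x k.+1 w) ^+ 2)%R] <= (rho ^+ 2)%:E)%E.

End BSG.

(* Maxima over blocks take 0 as neutral element: all maximized quantities are
   nonnegative. *)
Section Constants.
Context {R : realType} {s : nat} {n : 'I_s -> nat}.
Local Notation point := 'rV[R]_(\sum_(i < s) n i).

Definition weighted_avg {T : Type} (alpha : nat -> R) (x : nat -> T -> point)
    (K : nat) (w : T) : point :=
  (\sum_(1 <= k < K.+1) alpha k)^-1 *:
    \sum_(1 <= k < K.+1) alpha k *: x k.+1 w.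

Definition M_rho (F : point -> R) (L rho : R) : R :=
  Num.sqrt (4 * L ^+ 2 * rho ^+ 2 +
            2 * \big[Num.max/0]_(i < s) enorm (pgrad F i 0) ^+ 2).

Definition D_const (F : point -> R) (L theta A rho sigma : R) (Lr : 'I_s -> R)
    (xstar : point) : R :=
  let Lmax := \big[Num.max/0]_(i < s) Lr i in
  s%:R * (sigma ^+ 2 + 4 * Lmax ^+ 2) / (1 - L * theta) +
  Num.sqrt s%:R * (enorm xstar + rho) *
    (A + L * Num.sqrt (\sum_(j < s) (4 * M_rho F L rho ^+ 2 + 4 * sigma ^+ 2 +
                                      2 * Lr j ^+ 2))).

End Constants.

(* Main.v *)
(* The gradient inequality of F at x^{k+1} replaces the descent lemma:
     F(x^{k+1}) - F(xstar) <= sum_i <grad_i F(x^{k+1}), x_i^{k+1} - xstar_i>,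
   and exchanging grad_i F(x^{k+1}) for g_i^k costs at most
   L sqrt s |x^{k+1} - x^k| |x^{k+1} - xstar|. With the three-point inequality of the
   proximal step, Young's inequality and the conditional bias bound, alpha_k times
   the expected gap is at most
     (E|x^k - xstar|^2 - E|x^{k+1} - xstar|^2) / 2 + alpha_k^2 D,
   which telescopes; Jensen's inequality gives the averaged iterate.

   Two points need extra care. The starting point may be infeasible: the noise of
   the first iteration is then measured from the projection of x^1, and the excess
   of the first move is paid by squares otherwise dropped (its own square and that
   of the last distance to xstar). Moreover sum_{k <= K} 1 / sqrt k >= sqrt (K + 1)
   fails for K = 1 and K = 2; for K = 1 the errors are measured from the midpoint
   of x^1 and xstar, and for K = 2 a part of the squared moves is kept. *)
Require Import Defs.
From HB Require Import structures.
From mathcomp Require Import all_boot all_order all_algebra.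
From mathcomp Require Import all_classical all_reals all_analysis.
From mathcomp Require Import measurable_realfun ring lra.

Set Implicit Arguments.
Unset Strict Implicit.
Unset Printing Implicit Defensive.

Import Order.TTheory GRing.Theory Num.Theory.
Import numFieldNormedType.Exports.

Local Open Scope classical_set_scope.
Local Open Scope ring_scope.

(** All lengths are measured in the norm of L^2(P), so that an iteration becomes an inequality
    between a few real numbers: the distances q and p to the solution before and after, and the size
    d of the move. The bias of the noise is controlled only against vectors fixed before the
    mini-batch is drawn, whereas x^{k+1} depends on the batch. Hence x^{k+1} - xstar is split at a
    vector a known in advance: the part x^{k+1} - a is paid by the variance, the part a - xstar by
    the bias. For x^{k+1} - a to be of order alpha_k, the proximal step needs a in the closure of X,
    which is why an infeasible x^1 is replaced by its projection. A factor kap >= 1 on the error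
    terms keeps the fraction (1 - 1 / kap) / 2 of the squared moves: kap = 26 / 25 serves for two
    iterations, kap = 1 for the general bound. The threshold 17 / 5 separates two ways of paying for
    an infeasible start: below it the squared first move suffices, above it the last iterate is
    still far from the solution. *)

(** * Euclidean geometry of blocks *)

Section EuclideanAlgebra.
Context {R : realType}.

Lemma le_of_sqr (x y : R) : 0 <= y -> x ^+ 2 <= y ^+ 2 -> x <= y.
Proof. by move=> y0 xy; rewrite leNgt; apply/negP => yx; nra. Qed.

Lemma eq_of_sqr (x y : R) : 0 <= x -> 0 <= y -> x ^+ 2 = y ^+ 2 -> x = y.
Proof.
by move=> x0 y0 xy; apply: le_anti; apply/andP; split; apply: le_of_sqr; rewrite // xy.
Qed.

Section Dot.
Context {n : nat}.
Implicit Types (u v w : 'rV[R]_n) (a : R).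

Lemma dotvC u v : dotv u v = dotv v u.
Proof. by apply: eq_bigr => j _; rewrite mulrC. Qed.

Lemma dotvDr u v w : dotv u (v + w) = dotv u v + dotv u w.
Proof. by rewrite -big_split; apply: eq_bigr => j _; rewrite mxE mulrDr. Qed.

Lemma dotvZr a u v : dotv u (a *: v) = a * dotv u v.
Proof. by rewrite mulr_sumr; apply: eq_bigr => j _; rewrite mxE mulrCA. Qed.

Lemma dotvNr u v : dotv u (- v) = - dotv u v.
Proof. by rewrite -scaleN1r dotvZr mulN1r. Qed.

Lemma dotvBr u v w : dotv u (v - w) = dotv u v - dotv u w.
Proof. by rewrite dotvDr dotvNr. Qed.

Lemma dotv0r u : dotv u 0 = 0.
Proof. by rewrite -(scale0r 0) dotvZr mul0r. Qed.

Lemma dotvDl u v w : dotv (u + v) w = dotv u w + dotv v w.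
Proof. by rewrite !(dotvC _ w) dotvDr. Qed.

Lemma dotvZl a u v : dotv (a *: u) v = a * dotv u v.
Proof. by rewrite !(dotvC _ v) dotvZr. Qed.

Lemma dotvNl u v : dotv (- u) v = - dotv u v.
Proof. by rewrite !(dotvC _ v) dotvNr. Qed.

Lemma dotvBl u v w : dotv (u - v) w = dotv u w - dotv v w.
Proof. by rewrite dotvDl dotvNl. Qed.

Lemma dotv_ge0 u : 0 <= dotv u u.
Proof. by apply: sumr_ge0 => j _; rewrite -expr2 sqr_ge0. Qed.

Lemma sqr_enorm u : enorm u ^+ 2 = dotv u u.
Proof. by rewrite sqr_sqrtr ?dotv_ge0. Qed.

Lemma enorm_ge0 u : 0 <= enorm u.
Proof. exact: sqrtr_ge0. Qed.

Lemma enorm0 : enorm (0 : 'rV[R]_n) = 0.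
Proof. by rewrite /enorm dotv0r sqrtr0. Qed.

Lemma enormN u : enorm (- u) = enorm u.
Proof. by rewrite /enorm dotvNl dotvNr opprK. Qed.

Lemma enormBC u v : enorm (u - v) = enorm (v - u).
Proof. by rewrite -enormN opprB. Qed.

Lemma sqr_enormD u v :
  enorm (u + v) ^+ 2 = enorm u ^+ 2 + 2 * dotv u v + enorm v ^+ 2.
Proof. by rewrite !sqr_enorm dotvDl !dotvDr (dotvC v u); ring. Qed.

Lemma sqr_enormB u v :
  enorm (u - v) ^+ 2 = enorm u ^+ 2 - 2 * dotv u v + enorm v ^+ 2.
Proof. by rewrite sqr_enormD dotvNr enormN mulrN. Qed.

Lemma sqr_enormZ a u : enorm (a *: u) ^+ 2 = a ^+ 2 * enorm u ^+ 2.
Proof. by rewrite !sqr_enorm dotvZl dotvZr; ring. Qed.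

Lemma enormZ a u : 0 <= a -> enorm (a *: u) = a * enorm u.
Proof.
move=> a0; apply: eq_of_sqr; rewrite ?mulr_ge0 ?enorm_ge0//.
by rewrite sqr_enormZ exprMn.
Qed.

Lemma enorm_eq0 u : enorm u = 0 -> u = 0.
Proof.
move=> u0; have /eqP : dotv u u = 0 by rewrite -sqr_enorm u0 expr0n.
rewrite psumr_eq0 => [/allP {}u0|j _]; last by rewrite -expr2 sqr_ge0.
apply/rowP => j; rewrite mxE; apply/eqP.
by have := u0 j (mem_index_enum j); rewrite /= mulf_eq0 orbb.
Qed.

Lemma cauchy_schwarz_dotv u v : dotv u v <= enorm u * enorm v.
Proof.
have [u0|u0] := eqVneq (enorm u) 0.
  by rewrite (enorm_eq0 u0) dotvC dotv0r enorm0 mul0r.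
have {}u0 : 0 < enorm u by rewrite lt_neqAle eq_sym u0 enorm_ge0.
have [v0|v0] := eqVneq (enorm v) 0.
  by rewrite (enorm_eq0 v0) dotv0r enorm0 mulr0.
have {}v0 : 0 < enorm v by rewrite lt_neqAle eq_sym v0 enorm_ge0.
have := sqr_ge0 (enorm (enorm v *: u - enorm u *: v)).
rewrite sqr_enormB !sqr_enormZ dotvZl dotvZr => h.
rewrite -(ler_pM2l (mulr_gt0 u0 v0)); nra.
Qed.

Lemma cauchy_schwarz_dotvN u v : - dotv u v <= enorm u * enorm v.
Proof. by rewrite -dotvNl -(enormN u) cauchy_schwarz_dotv. Qed.

Lemma enormD u v : enorm (u + v) <= enorm u + enorm v.
Proof.
apply: le_of_sqr; rewrite ?addr_ge0 ?enorm_ge0// sqr_enormD sqrrD.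
by have := cauchy_schwarz_dotv u v; lra.
Qed.

(* Stewart's theorem *)
Lemma sqr_enorm_conv a u v w :
  enorm (u - ((1 - a) *: v + a *: w)) ^+ 2 =
  (1 - a) * enorm (u - v) ^+ 2 + a * enorm (u - w) ^+ 2
    - a * (1 - a) * enorm (v - w) ^+ 2.
Proof.
have -> : u - ((1 - a) *: v + a *: w) = (1 - a) *: (u - v) + a *: (u - w).
  by apply/rowP => j; rewrite !mxE; ring.
have -> : v - w = (u - w) - (u - v) by apply/rowP => j; rewrite !mxE; ring.
rewrite (sqr_enormD (_ *: _)) (sqr_enormB (u - w)) !sqr_enormZ dotvZl dotvZr.
by rewrite (dotvC (u - w)); ring.
Qed.

End Dot.

Section Blocks.
Context {s : nat} {n : 'I_s -> nat}.
Local Notation point := 'rV[R]_(\sum_(i < s) n i).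
Implicit Types u v : point.

Lemma dotv_blocks u v :
  dotv u v = \sum_(i < s) dotv (submxrow u i) (submxrow v i).
Proof.
rewrite /dotv sig_big_dep/= (reindex _ tagnat.sig_bij_on)/=.
by apply: eq_bigr => j _; rewrite !mxE tagnat.sig2K.
Qed.

Lemma sqr_enorm_blocks u :
  enorm u ^+ 2 = \sum_(i < s) enorm (submxrow u i) ^+ 2.
Proof. by rewrite sqr_enorm dotv_blocks; under [RHS]eq_bigr do rewrite sqr_enorm. Qed.

Lemma sum_enorm_blocks u :
  \sum_(i < s) enorm (submxrow u i) <= Num.sqrt s%:R * enorm u.
Proof.
apply: le_of_sqr; first by rewrite ?mulr_ge0 ?sqrtr_ge0 ?enorm_ge0//.
rewrite exprMn sqr_sqrtr ?ler0n// sqr_enorm_blocks.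
(* Cauchy-Schwarz in R^s between the vector of block norms and the all-ones vector. *)
pose a := \row_(i < s) enorm (submxrow u i).
pose b : 'rV[R]_s := const_mx 1.
have -> : \sum_(i < s) enorm (submxrow u i) = dotv b a.
  by apply: eq_bigr => i _; rewrite !mxE mul1r.
have -> : \sum_(i < s) enorm (submxrow u i) ^+ 2 = enorm a ^+ 2.
  by rewrite sqr_enorm; apply: eq_bigr => i _; rewrite !mxE expr2.
have -> : s%:R = enorm b ^+ 2.
  rewrite sqr_enorm /dotv; under eq_bigr do rewrite !mxE mulr1.
  by rewrite sumr_const card_ord.
rewrite -exprMn ler_sqr ?nnegrE ?mulr_ge0 ?enorm_ge0//.
  exact: cauchy_schwarz_dotv.
by apply: sumr_ge0 => i _; rewrite !mxE mul1r enorm_ge0.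
Qed.

Lemma enorm_blocks_le u v :
  (forall i, enorm (submxrow u i) <= enorm (submxrow v i)) ->
  enorm u <= enorm v.
Proof.
move=> uv; apply: le_of_sqr; rewrite ?enorm_ge0// !sqr_enorm_blocks.
by apply: ler_sum => i _; rewrite ler_sqr ?nnegrE ?enorm_ge0.
Qed.

End Blocks.
End EuclideanAlgebra.

(** * Real inequalities for one and two iterations *)

Section ScalarBounds.
Context {R : realType}.
Implicit Types (kap d b lam del Y X u rho r e : R).

(** Young's inequality spends d^2 / (4 kap) on each of the terms in [lam] and [del]. What remains of
    d^2 / 2 is kept on the right. *)
Lemma young_step kap d b lam del : 1 <= kap -> 0 <= b -> b <= d ->
  - (d ^+ 2 / 2) + 2 * lam * d + del * b <=
  kap * (del ^+ 2 + 4 * lam ^+ 2) - (1 - kap^-1) / 2 * d ^+ 2.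
Proof.
move=> kap1 b0 bd; have kap0 : 0 < kap by lra.
have -> : (1 - kap^-1) / 2 * d ^+ 2 = d ^+ 2 / 2 - (d ^+ 2) / (2 * kap).
  by field; lra.
have h1 : 2 * lam * d <= d ^+ 2 / (4 * kap) + 4 * kap * lam ^+ 2.
  rewrite -subr_ge0 (_ : _ - _ = (d - 4 * kap * lam) ^+ 2 / (4 * kap)).
    by rewrite divr_ge0 ?sqr_ge0//; lra.
  by field; lra.
have h2 : del * b <= b ^+ 2 / (4 * kap) + kap * del ^+ 2.
  rewrite -subr_ge0 (_ : _ - _ = (b - 2 * kap * del) ^+ 2 / (4 * kap)).
    by rewrite divr_ge0 ?sqr_ge0//; lra.
  by field; lra.
have h3 : b ^+ 2 / (4 * kap) <= d ^+ 2 / (4 * kap).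
  by rewrite ler_pM2r ?invr_gt0 ?mulr_gt0//; nra.
have -> : d ^+ 2 / (2 * kap) = 2 * (d ^+ 2 / (4 * kap)) by field; lra.
lra.
Qed.

(** The last hypothesis gives X <= Y - del, because 4 (Y - del)^2 - 3 (Y^2 - 4 del^2) = (Y - 4
    del)^2. With Y - del in place of X, the two sides differ by the square (d - 2 Y + 2 del)^2 /
    4. *)
Lemma excess_core d Y del X : 0 <= del -> 0 <= Y -> Y <= d -> 0 <= X ->
  4 * X ^+ 2 <= 3 * (Y ^+ 2 - 4 * del ^+ 2) ->
  X * (d - Y) <= d ^+ 2 / 4 - del * Y + del ^+ 2.
Proof.
move=> del0 Y0 Yd X0 XY.
have dY : 2 * del <= Y by apply: le_of_sqr => //; nra.
have XA : X <= Y - del.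
  apply: le_of_sqr; first by lra.
  have := sqr_ge0 (Y - 4 * del); nra.
have : 0 <= (Y - del - X) * (d - Y) by rewrite mulr_ge0//; lra.
have := sqr_ge0 (d - Y - (Y - 2 * del)); nra.
Qed.

(* In this lemma [d], [b] and [Y] are the length of the first move, the distance of
   the new iterate to the projection of the starting point, and the a priori bound
   on [b]; for a feasible starting point [d = b <= Y] and [e] can be [0].
   Otherwise [d] may exceed [Y]; the loss [u r (d - Y)] is absorbed by the
   square [d ^+ 2] as long as [r <= 17 / 5 * rho], and is at most [r rho / 4]
   in all cases. *)
Lemma infeasible_step kap d b lam del Y u rho r e :
  1 <= kap -> 0 <= b -> b <= d -> b <= Y -> d <= 2 * rho -> 0 <= del ->
  0 <= u -> 0 <= rho -> 0 <= r ->
  16 * u ^+ 2 * rho ^+ 2 + 4 * del ^+ 2 <= Y ^+ 2 ->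
  0 <= e -> (17 / 5 * rho < r -> r * rho / 4 <= e) ->
  - (d ^+ 2 / 2) + 2 * lam * d + del * b + u * r * d <=
  kap * (del ^+ 2 + 4 * lam ^+ 2 + u * r * Y) - (1 - kap^-1) / 2 * d ^+ 2 + e.
Proof.
move=> kap1 b0 bd bY d2 del0 u0 rho0 r0 uY e0 re.
have Y0 : 0 <= Y by lra.
have kap0 : 0 < kap by lra.
have ur0 : 0 <= u * r by rewrite mulr_ge0.
have [dY|Yd] := leP d (kap * Y).
  have := young_step lam del kap1 b0 bd.
  have : u * r * d <= u * r * (kap * Y) by rewrite ler_wpM2l.
  lra.
have [rr|rr] := leP r (17 / 5 * rho); last first.
  have := young_step lam del kap1 b0 bd.
  have Y4 : 4 * u * rho <= Y by apply: le_of_sqr => //; nra.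
  have h1 : u * r * (d - kap * Y) <= (u * r) * (2 * rho - kap * (4 * u * rho)).
    by rewrite ler_wpM2l// lerB// ler_wpM2l// ltW.
  (* This is 2 u - 4 kap u^2 <= 1 / 4, a completed square when kap = 1. *)
  have h2 : (u * r) * (2 * rho - kap * (4 * u * rho)) <= r * rho / 4.
    have rr0 : 0 <= r * rho by rewrite mulr_ge0.
    have : 0 <= r * rho * ((1 - 4 * u) ^+ 2 + 16 * (kap - 1) * u ^+ 2).
      by rewrite mulr_ge0// addr_ge0 ?sqr_ge0// mulr_ge0 ?sqr_ge0// mulr_ge0//; lra.
    nra.
  have := re rr; lra.
(* [excess_core] is applied with Y, del and u r scaled by kap. Its hypothesis reduces to 4 r^2 <= 48
   rho^2, and 17 / 5 is below sqrt 12. *)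
have core : kap * (u * r) * (d - kap * Y) <=
    d ^+ 2 / 4 - kap * del * (kap * Y) + (kap * del) ^+ 2.
  apply: excess_core => //; rewrite ?mulr_ge0// ?(ltW Yd)//; try lra.
  have : u ^+ 2 * r ^+ 2 <= u ^+ 2 * (17 / 5 * rho) ^+ 2.
    by rewrite ler_wpM2l ?sqr_ge0// ler_sqr ?nnegrE//; lra.
  have -> : 4 * (kap * (u * r)) ^+ 2 = kap ^+ 2 * (4 * (u ^+ 2 * r ^+ 2)) by ring.
  have -> : 3 * ((kap * Y) ^+ 2 - 4 * (kap * del) ^+ 2) =
    kap ^+ 2 * (3 * (Y ^+ 2 - 4 * del ^+ 2)) by ring.
  move=> ur; rewrite ler_wpM2l ?sqr_ge0//.
  have : 0 <= u ^+ 2 * rho ^+ 2 by rewrite mulr_ge0 ?sqr_ge0.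
  nra.
have h1 : 2 * lam * d <= d ^+ 2 / (4 * kap) + 4 * kap * lam ^+ 2.
  rewrite -subr_ge0 (_ : _ - _ = (d - 4 * kap * lam) ^+ 2 / (4 * kap)).
    by rewrite divr_ge0 ?sqr_ge0//; lra.
  by field; lra.
have h2 : del * b <= kap * (del * Y).
  have : 0 <= (kap - 1) * (del * Y) by rewrite !mulr_ge0//; lra.
  have : del * b <= del * Y by rewrite ler_wpM2l.
  lra.
have h3 : u * r * (d - kap * Y) <=
    d ^+ 2 / (4 * kap) - kap * (del * Y) + kap * del ^+ 2.
  rewrite -(ler_pM2l kap0) (_ : kap * (u * r * _) = kap * (u * r) * (d - kap * Y));
    last by ring.
  rewrite (le_trans core)// le_eqVlt; apply/orP; left.
  by apply/eqP; field; lra.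
have -> : (1 - kap^-1) / 2 * d ^+ 2 = d ^+ 2 / 2 - 2 * (d ^+ 2 / (4 * kap)).
  by field; lra.
lra.
Qed.

Lemma feasible_step_bound kap lam del u Y r c DD q p d E :
  1 <= kap -> 0 <= d -> d <= Y -> 0 <= p -> p <= r -> q <= r -> 0 <= u -> 0 <= c ->
  del ^+ 2 + 4 * lam ^+ 2 + c * r + u * r * Y <= DD ->
  E <= (q ^+ 2 - p ^+ 2 - d ^+ 2) / 2 + 2 * lam * d + del * d + c * q + u * d * p ->
  E <= (q ^+ 2 - p ^+ 2) / 2 + kap * DD - (1 - kap^-1) / 2 * d ^+ 2.
Proof.
move=> kap1 d0 dY p0 pr qr u0 c0 hDD hE.
have y := young_step lam del kap1 d0 (lexx d).
have h1 : c * q <= c * r by rewrite ler_wpM2l.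
have h2 : u * d * p <= u * r * Y.
  by rewrite -!mulrA ler_wpM2l// mulrC ler_pM.
have r0 : 0 <= r by exact: le_trans pr.
have h3 : 0 <= (kap - 1) * (c * r + u * r * Y).
  by rewrite mulr_ge0 ?subr_ge0// addr_ge0 ?mulr_ge0// (le_trans d0).
have h4 : kap * (del ^+ 2 + 4 * lam ^+ 2 + c * r + u * r * Y) <= kap * DD.
  by rewrite ler_wpM2l// (le_trans ler01).
clear - y hE h1 h2 h3 h4; lra.
Qed.

Lemma infeasible_step_bound kap lam del u Y r c DD q p d b w rho e E :
  1 <= kap -> 0 <= b -> b <= d -> b <= Y -> d <= 2 * rho -> 0 <= rho -> 0 <= del ->
  0 <= p -> p <= r -> w <= r -> 0 <= u -> 0 <= c ->
  16 * u ^+ 2 * rho ^+ 2 + 4 * del ^+ 2 <= Y ^+ 2 ->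
  0 <= e -> (17 / 5 * rho < r -> r * rho / 4 <= e) ->
  del ^+ 2 + 4 * lam ^+ 2 + c * r + u * r * Y <= DD ->
  E <= (q ^+ 2 - p ^+ 2 - d ^+ 2) / 2 + 2 * lam * d + del * b + c * w + u * d * p ->
  E <= (q ^+ 2 - p ^+ 2) / 2 + kap * DD - (1 - kap^-1) / 2 * d ^+ 2 + e.
Proof.
move=> kap1 b0 bd bY d2 rho0 del0 p0 pr wr u0 c0 uY e0 re hDD hE.
have r0 : 0 <= r by exact: le_trans pr.
have y := infeasible_step lam kap1 b0 bd bY d2 del0 u0 rho0 r0 uY e0 re.
have d0 : 0 <= d by exact: le_trans bd.
have h1 : c * w <= c * r by rewrite ler_wpM2l.
have h2 : u * d * p <= u * r * d.
  by rewrite -!mulrA ler_wpM2l// mulrC ler_wpM2r.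
have h3 : 0 <= (kap - 1) * (c * r) by rewrite !mulr_ge0 ?subr_ge0.
have h4 : kap * (del ^+ 2 + 4 * lam ^+ 2 + c * r + u * r * Y) <= kap * DD.
  by rewrite ler_wpM2l// (le_trans ler01).
clear - y hE h1 h2 h3 h4; lra.
Qed.

(* [h] is the distance from the new iterate to the midpoint of the starting
   point and the solution, which are at distance [q] from each other. Measuring
   the errors from the midpoint gains the factor [7 / 10 < 1 / sqrt 2]. *)
Lemma midpoint_step q p d h sr sd a u rho r Y :
  0 <= p -> 0 <= d -> 0 <= a -> 0 <= u ->
  h ^+ 2 = (p ^+ 2 + d ^+ 2) / 2 - q ^+ 2 / 4 ->
  d <= 2 * rho -> p <= r -> 4 * u * rho <= Y ->
  (q ^+ 2 - p ^+ 2 - d ^+ 2) / 2 + (sr + sd) * h + a / 2 + u * d * p <=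
  7 / 10 * (sr ^+ 2 + sd ^+ 2 + a + u * r * Y + q ^+ 2 / 2).
Proof.
move=> p0 d0 a0 u0 hE d2 pr uY.
have r0 : 0 <= r by lra.
have dp0 : 0 <= d * p by rewrite mulr_ge0.
(* The weight 5 / 7 is 1 / (2 * 7/10), chosen to give [sr] and [sd] the factor 7 / 10. *)
have h1 : (sr + sd) * h <= 5 / 7 * h ^+ 2 + 7 / 10 * (sr ^+ 2 + sd ^+ 2).
  have := sqr_ge0 (sr - sd); have := sqr_ge0 (5 / 7 * h - (sr + sd) / 2); nra.
have h2 : 2 * u ^+ 2 * (d * p) <= u * r * Y.
  have : u * r * (4 * u * rho) <= u * r * Y by rewrite ler_wpM2l ?mulr_ge0.
  have : u ^+ 2 * (2 * (d * p)) <= u ^+ 2 * (2 * (2 * rho * r)).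
    by rewrite ler_wpM2l ?sqr_ge0// ler_pM2l// ler_pM.
  lra.
(* The maximum is at u = 5 / 14. The squares in h leave (p^2 + d^2) / 7 unspent, which absorbs 5 /
   28 d p. *)
have h3 : (u - 7 / 5 * u ^+ 2) * (d * p) <= 5 / 28 * (d * p).
  by rewrite ler_wpM2r//; have := sqr_ge0 (u - 5 / 14); nra.
have := sqr_ge0 (d - p); have := sqr_ge0 h; nra.
Qed.

Lemma midpoint_step_bound lam del u Y r c DD q p d h rho E :
  0 <= p -> 0 <= d -> 0 <= u -> 0 <= c -> 0 <= rho -> 0 <= Y ->
  h ^+ 2 = (p ^+ 2 + d ^+ 2) / 2 - q ^+ 2 / 4 ->
  d <= 2 * rho -> p <= r -> q <= r ->
  16 * u ^+ 2 * rho ^+ 2 + 4 * del ^+ 2 <= Y ^+ 2 ->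
  del ^+ 2 + 4 * lam ^+ 2 + c * r + u * r * Y <= DD ->
  E <= (q ^+ 2 - p ^+ 2 - d ^+ 2) / 2 + 2 * lam * h + del * h + c * (q / 2) +
    u * d * p ->
  E <= 7 / 10 * (DD + q ^+ 2 / 2).
Proof.
move=> p0 d0 u0 c0 rho0 Y0 hE d2 pr qr uY hDD E_le.
have r0 : 0 <= r by exact: le_trans pr.
have cr0 : 0 <= c * r by rewrite mulr_ge0.
have Y4 : 4 * u * rho <= Y.
  apply: le_of_sqr => //; apply: le_trans uY.
  by rewrite !exprMn -natrX lerDl mulr_ge0 ?sqr_ge0.
have := midpoint_step (2 * lam) del p0 d0 cr0 u0 hE d2 pr Y4.
have h1 : c * q <= c * r by rewrite ler_wpM2l.
clear - hDD E_le h1; lra.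
Qed.

Lemma combine_step_terms E Q2 P2 D2 B C G q p d z r1 r2 al (A L sq lmax sig : R) :
  E = 2^-1 * (Q2 - P2 - D2) + 2 * al * lmax * sq * B - al * C + al * L * sq * G ->
  q ^+ 2 = Q2 -> p ^+ 2 = P2 -> d ^+ 2 = D2 ->
  0 <= al -> 0 <= L -> 0 <= sq -> 0 <= lmax -> B <= z ->
  - C <= sq * sig * r1 + A * al * (sq * r2) -> G <= d * p ->
  E <= (q ^+ 2 - p ^+ 2 - d ^+ 2) / 2 + 2 * (al * sq * lmax) * z +
    (al * sq * sig) * r1 + al ^+ 2 * A * sq * r2 + (al * L * sq) * d * p.
Proof.
move=> -> <- <- <- al0 L0 sq0 l0 Bz Ce Gd.
have h1 : 2 * al * lmax * sq * B <= 2 * al * lmax * sq * z.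
  by rewrite ler_wpM2l ?mulr_ge0.
have h2 : al * - C <= al * (sq * sig * r1 + A * al * (sq * r2)).
  by rewrite ler_wpM2l.
have h3 : al * L * sq * G <= al * L * sq * (d * p) by rewrite ler_wpM2l ?mulr_ge0.
clear - h1 h2 h3; lra.
Qed.

(** The right side is the square of [Yc] written out: 4 L^2 rho2 + 2 g stands for the square of
    [M_rho], with g the largest squared block gradient at 0. *)
Lemma proj_radius_le (L sr rho2 g e2 q c sig2 l : R) :
  e2 <= sr * sig2 -> c <= sr * (8 * g) + 2 * l ->
  q <= 8 * L ^+ 2 * sr * (2 * rho2) ->
  q + 4 * e2 + c <= sr * (4 * (4 * L ^+ 2 * rho2 + 2 * g) + 4 * sig2) + 2 * l.
Proof. lra. Qed.

Lemma midpoint_sqr (h2 P2 D2 Q2 p d q : R) :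
  h2 = 2^-1 * P2 + 2^-1 * D2 + - 4^-1 * Q2 ->
  p ^+ 2 = P2 -> d ^+ 2 = D2 -> q ^+ 2 = Q2 ->
  h2 = (p ^+ 2 + d ^+ 2) / 2 - q ^+ 2 / 4.
Proof. by move=> -> <- <- <-; field. Qed.

(* [r - 2 rho] is a lower bound for the distance [p] of the last iterate to the
   solution, so the square dropped by the telescoping pays for the excess. *)
Lemma excess_le r rho p : 0 <= rho -> r - 2 * rho <= p -> 17 / 5 * rho < r ->
  r * rho / 4 <= p ^+ 2 / 2.
Proof.
move=> rho0 rp rr.
have h : (r - 2 * rho) ^+ 2 <= p ^+ 2 by rewrite ler_sqr ?nnegrE; lra.
have : 0 <= (r - 17 / 5 * rho) * rho by rewrite mulr_ge0//; lra.
have := sqr_ge0 (r - 17 / 5 * rho); nra.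
Qed.

(** Without excess, Cauchy-Schwarz with weights 2, 52, 52 gives q^2 <= 106 (p^2 / 2 + (d1^2 + d2^2)
    / 52), and 1 / 106 >= 1 / 132 = 1 / 2 - 65 / 132. With excess, (r - 2 rho)^2 / 2 must cover r
    rho / 4 + r^2 / 132. This holds for r / rho above about 3.36, so 17 / 5 lies between this value
    and sqrt 12. *)
Lemma two_step_slack q r rho p d1 d2 e : 0 <= rho -> 0 <= q ->
  q <= r -> q <= p + d1 + d2 -> r - 2 * rho <= p ->
  e = (if 17 / 5 * rho < r then r * rho / 4 else 0) ->
  (q ^+ 2 - p ^+ 2) / 2 - (d1 ^+ 2 + d2 ^+ 2) / 52 + e <= 65 / 132 * q ^+ 2.
Proof.
move=> rho0 q0 qr qd rp ->; have [rr|_] := ltP.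
  have h : (r - 2 * rho) ^+ 2 <= p ^+ 2 by rewrite ler_sqr ?nnegrE; lra.
  have hq : q ^+ 2 <= r ^+ 2 by rewrite ler_sqr ?nnegrE; lra.
  have : 0 <= (r - 17 / 5 * rho) * rho by rewrite mulr_ge0//; lra.
  have := sqr_ge0 (r - 17 / 5 * rho); have := sqr_ge0 d1; have := sqr_ge0 d2.
  clear - h hq; nra.
have hq : q ^+ 2 <= (p + d1 + d2) ^+ 2 by rewrite ler_sqr ?nnegrE//; lra.
have h1 := sqr_ge0 (p - d1 / 26); have h2 := sqr_ge0 (p - d2 / 26).
have h3 := sqr_ge0 (d1 - d2); have h4 := sqr_ge0 q.
clear - hq h1 h2 h3 h4; lra.
Qed.

Lemma two_step_close S q r rho p d1 d2 e a1 a2 DD : 0 <= rho -> 0 <= q ->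
  q <= r -> q <= p + d1 + d2 -> r - 2 * rho <= p ->
  e = (if 17 / 5 * rho < r then r * rho / 4 else 0) ->
  S <= (q ^+ 2 - p ^+ 2) / 2 + 26 / 25 * (a1 * DD + a2 * DD) -
    (1 - (26 / 25)^-1) / 2 * (d1 ^+ 2 + d2 ^+ 2) + e ->
  S <= 65 / 132 * q ^+ 2 + 26 / 25 * (a1 + a2) * DD.
Proof.
move=> rho0 q0 qr qd rp ee.
have := two_step_slack rho0 q0 qr qd rp ee.
have -> : (1 - (26 / 25)^-1) / 2 = 52^-1 :> R by field.
move=> h1 h2; clear - h1 h2; lra.
Qed.

Lemma one_factor_close S q2 p2 B M e : S <= (q2 - p2) / 2 + 1 * B -
    (1 - 1^-1) / 2 * M + e -> e <= p2 / 2 -> S <= q2 / 2 + B.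
Proof. by rewrite invr1 subrr mul0r mul0r; lra. Qed.

Lemma telescope_le (E a b m : nat -> R) kap c e K : (0 < K)%N ->
  E 1%N <= (a 1%N - a 2%N) / 2 + kap * b 1%N - c * m 1%N + e ->
  (forall k, (2 <= k <= K)%N -> E k <= (a k - a k.+1) / 2 + kap * b k - c * m k) ->
  \sum_(1 <= k < K.+1) E k <= (a 1%N - a K.+1) / 2 +
    kap * \sum_(1 <= k < K.+1) b k - c * \sum_(1 <= k < K.+1) m k + e.
Proof.
move=> + E1; elim: K => // -[_ _ _|K IH _ Ek]; first by rewrite !big_nat1.
rewrite !(@big_nat_recr _ _ _ K.+2)//= !mulrDr.
have IHK : forall k, (2 <= k <= K.+1)%N ->
    E k <= (a k - a k.+1) / 2 + kap * b k - c * m k.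
  by move=> k /andP[k2 kK]; apply: Ek; rewrite k2 leqW.
have := IH isT IHK; have := Ek K.+2; rewrite leqnn => /(_ isT).
move: (\sum_(1 <= k < K.+2) E k) (\sum_(1 <= k < K.+2) b k)
  (\sum_(1 <= k < K.+2) m k) => SE Sb Sm h1 h2.
clear - h1 h2; lra.
Qed.

End ScalarBounds.

(** * Convexity and the proximal step *)

Section Convexity.
Context {R : realType} {n : nat}.
Implicit Types (u v w x y a : 'rV[R]_n) (C : set 'rV[R]_n) (t : R).

Lemma convex_setE C u v t : convex_set C -> C u -> C v -> 0 <= t -> t <= 1 ->
  C ((1 - t) *: u + t *: v).
Proof.
move=> cC Cu Cv t0 t1.
have := cC v u (Itv01 t0 t1); rewrite !inE => /(_ Cv Cu).
by rewrite /conv/= addrC.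
Qed.

Lemma convex_functionE (h : 'rV[R]_n -> R) u v t :
  convex_function setT h -> 0 <= t -> t <= 1 ->
  h ((1 - t) *: u + t *: v) <= (1 - t) * h u + t * h v.
Proof.
move=> ch t0 t1; have := ch (Itv01 t0 t1) v u; rewrite !inE => /(_ I I).
by rewrite /conv/= addrC [leRHS]addrC.
Qed.

Lemma derive_dotv_grad (F : 'rV[R]_n -> R) x v : differentiable F x ->
  'D_v F x = dotv (grad F x) v.
Proof.
move=> dF; rewrite deriveE// {1}(row_sum_delta v) linear_sum/=.
by apply: eq_bigr => j _; rewrite linearZ/= mxE deriveE// mulrC.
Qed.

Lemma convex_gradient_le (F : 'rV[R]_n -> R) x y :
  convex_function setT F -> differentiable F x ->
  F x + dotv (grad F x) (y - x) <= F y.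
Proof.
move=> cF dF; rewrite -derive_dotv_grad// addrC -lerBrDr.
have dv : derivable F x (y - x) by exact: diff_derivable.
have cv : (fun h : R => h^-1 *: ((F \o shift x) (h *: (y - x)) - F x)) @ 0^'+
    --> 'D_(y - x) F x.
  exact: cvg_dnbhs_at_right dv.
apply: (cvgr_to_le cv); near=> t.
have t0 : 0 < t by [].
have t1 : t <= 1 by near: t; apply: nbhs_right_le.
rewrite /= [leLHS](_ : _ = t^-1 * (F (t *: (y - x) + x) - F x))//.
rewrite mulrC ler_pdivrMr//.
have -> : t *: (y - x) + x = (1 - t) *: x + t *: y.
  by apply/rowP => j; rewrite !mxE; ring.
by have := convex_functionE x y cF (ltW t0) t1; lra.
Unshelve. all: by end_near. Qed.

(** Finite Jensen inequality by induction on K, the last point entering with relative weight t.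
    Membership in C is carried along because the convexity of phi is assumed on C. *)
Lemma convex_avg C (phi : 'rV[R]_n -> R) (a : nat -> R) (y : nat -> 'rV[R]_n) K :
  (forall u v t, C u -> C v -> 0 <= t -> t <= 1 -> C ((1 - t) *: u + t *: v) /\
     phi ((1 - t) *: u + t *: v) <= (1 - t) * phi u + t * phi v) ->
  (0 < K)%N -> (forall k, (1 <= k <= K)%N -> 0 < a k) ->
  (forall k, (1 <= k <= K)%N -> C (y k)) ->
  let avg := (\sum_(1 <= k < K.+1) a k)^-1 *: \sum_(1 <= k < K.+1) a k *: y k in
  C avg /\ phi avg <=
    (\sum_(1 <= k < K.+1) a k)^-1 * \sum_(1 <= k < K.+1) a k * phi (y k).
Proof.
move=> conv; elim: K => // -[_ _|K IH _] a_gt0 Cy /=.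
  have a1 := a_gt0 1%N isT; rewrite !big_nat1 scalerA mulrA mulVf ?gt_eqF//.
  by rewrite scale1r mul1r; split => //; exact: Cy.
have [|k /andP[k1 kK]|k /andP[k1 kK]|] := IH => //.
- by apply: a_gt0; rewrite k1 leqW.
- by apply: Cy; rewrite k1 leqW.
rewrite (_ : \sum_(1 <= k < K.+3) a k = \sum_(1 <= k < K.+2) a k + a K.+2);
  last by rewrite big_nat_recr.
rewrite (_ : \sum_(1 <= k < K.+3) a k *: y k =
  \sum_(1 <= k < K.+2) a k *: y k + a K.+2 *: y K.+2); last by rewrite big_nat_recr.
rewrite (_ : \sum_(1 <= k < K.+3) a k * phi (y k) =
  \sum_(1 <= k < K.+2) a k * phi (y k) + a K.+2 * phi (y K.+2));
  last by rewrite big_nat_recr.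
set S := \sum_(1 <= k < K.+2) a k; set V := \sum_(1 <= k < K.+2) a k *: y k.
set W := \sum_(1 <= k < K.+2) a k * phi (y k).
move=> CV phiV.
have aK : 0 < a K.+2 by apply: a_gt0; rewrite leqnn.
have S0 : 0 < S.
  rewrite /S big_nat_recr//= ltr_wpDl// ?a_gt0// ?leqnSn//.
  rewrite big_nat_cond; apply: sumr_ge0 => k /andP[/andP[k1 kK] _].
  by apply/ltW/a_gt0; rewrite k1 (leq_trans (ltnW kK)).
pose t := a K.+2 / (S + a K.+2).
have t0 : 0 <= t by rewrite divr_ge0// ?addr_ge0// ltW.
have t1 : t <= 1 by rewrite ler_pdivrMr ?addr_gt0// mul1r lerDr ltW.
have CyK : C (y K.+2) by apply: Cy; rewrite leqnn.
have SaK : S + a K.+2 != 0 by rewrite gt_eqF ?addr_gt0.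
have [] := conv _ _ _ CV CyK t0 t1.
have e : (1 - t) * S^-1 = (S + a K.+2)^-1.
  by rewrite /t; field; rewrite SaK gt_eqF.
have et : t = (S + a K.+2)^-1 * a K.+2 by rewrite mulrC.
have -> : (1 - t) *: (S^-1 *: V) + t *: y K.+2 =
    (S + a K.+2)^-1 *: (V + a K.+2 *: y K.+2).
  by rewrite scalerDr !scalerA e -et.
move=> CC pp; split => //; apply: le_trans pp _.
have t1' : 0 <= 1 - t by rewrite subr_ge0.
have := ler_wpM2l t1' phiV; rewrite [_ * (S^-1 * W)]mulrA e et mulrDr; lra.
Qed.

Lemma le_of_scaled_le (N G : R) : 0 <= N ->
  (forall t, 0 < t -> t <= 1 -> (1 - t) * N <= G) -> N <= G.
Proof.
move=> N0 GN; rewrite leNgt; apply/negP => GltN.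
have G0 : 0 <= G by have := GN 1; rewrite subrr mul0r; apply.
have Ngt0 : 0 < N by lra.
(* For this t, (1 - t) N is the midpoint of N and G, hence above G. *)
have t0 : 0 < (N - G) / (2 * N) by rewrite divr_gt0//; lra.
have t1 : (N - G) / (2 * N) <= 1 by rewrite ler_pdivrMr; lra.
have := GN _ t0 t1.
have -> : (1 - (N - G) / (2 * N)) * N = (N + G) / 2 by field; rewrite gt_eqF.
lra.
Qed.

(** The quadratic is strongly convex: on the segment from u to w, [sqr_enorm_conv] gains c t (1 - t)
    |w - u|^2. Minimality of u is divided by t, and t tends to 0. *)
Lemma prox_three_point C (phi : 'rV[R]_n -> R) (c : R) x u w :
  0 < c -> C u -> C w ->
  (forall t, 0 <= t -> t <= 1 -> C ((1 - t) *: u + t *: w) /\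
     phi ((1 - t) *: u + t *: w) <= (1 - t) * phi u + t * phi w) ->
  (forall y, C y ->
     phi u + c * enorm (u - x) ^+ 2 <= phi y + c * enorm (y - x) ^+ 2) ->
  phi u + c * enorm (u - x) ^+ 2 + c * enorm (w - u) ^+ 2 <=
  phi w + c * enorm (w - x) ^+ 2.
Proof.
move=> c0 Cu Cw conv_phi umin.
pose G := phi w + c * enorm (w - x) ^+ 2 - phi u - c * enorm (u - x) ^+ 2.
pose N := c * enorm (w - u) ^+ 2.
have N0 : 0 <= N by rewrite mulr_ge0 ?sqr_ge0// ltW.
have GN t : 0 < t -> t <= 1 -> (1 - t) * N <= G.
  move=> t0 t1; have [Ct phit] := conv_phi t (ltW t0) t1.
  have := umin _ Ct.
  rewrite (enormBC (_ + _) x) sqr_enorm_conv (enormBC x u) (enormBC x w).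
  rewrite (enormBC u w) => h.
  rewrite -(ler_pM2l t0) /G /N; nra.
by have := le_of_scaled_le N0 GN; rewrite /G /N; lra.
Qed.

End Convexity.

Section BlockStep.
Context {R : realType} {n : nat}.
Implicit Types (u v w a g : 'rV[R]_n) (C : set 'rV[R]_n) (t : R).

(* [a] is a projection of [u] on the closure of [C], in the two forms that are
   used: the obtuse angle criterion and adherence to [C]. *)
Definition is_proj C u a : Prop :=
  (forall w, C w -> enorm (a - u) ^+ 2 + enorm (w - a) ^+ 2 <= enorm (w - u) ^+ 2)
  /\ forall e, 0 < e -> exists2 w, C w & enorm (w - a) <= e.

Lemma is_proj_self C u : C u -> is_proj C u u.
Proof.
move=> Cu; split=> [w _|e e0]; first by rewrite subrr enorm0 expr0n add0r.
by exists u => //; rewrite subrr enorm0 ltW.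
Qed.

Lemma is_proj_enormBl C u a w : is_proj C u a -> C w ->
  enorm (w - a) <= enorm (w - u).
Proof.
move=> [h _] Cw; apply: le_of_sqr; rewrite ?enorm_ge0//.
by have := h w Cw; have := sqr_ge0 (enorm (a - u)); lra.
Qed.

Variables (C : set 'rV[R]_n) (r : 'rV[R]_n -> R) (lam alpha : R).
Hypotheses (cC : convex_set C) (cr : convex_function setT r).
Hypotheses (lam0 : 0 <= lam) (alpha0 : 0 < alpha).
Hypothesis rL : forall u v, `|r u - r v| <= lam * enorm (u - v).

Lemma lipschitz_le u v : r u - r v <= lam * enorm (u - v).
Proof. exact: le_trans (ler_norm _) (rL u v). Qed.

Lemma subgradient_enorm u v : subgradient r u v -> enorm v <= lam.
Proof.
move=> /(_ (u + v)); rewrite addrAC subrr add0r -sqr_enorm => h.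
have := lipschitz_le (u + v) u; rewrite addrAC subrr add0r => h'.
have [->//|v0] := eqVneq (enorm v) 0.
have {}v0 : 0 < enorm v by rewrite lt_neqAle eq_sym v0 enorm_ge0.
by rewrite -(ler_pM2r v0); lra.
Qed.

Definition prox_update g u u' : Prop :=
  let model v w := dotv v (w - u) + (2 * alpha)^-1 * enorm (w - u) ^+ 2 in
  (C = setT -> is_argmin setT (fun w => model g w + r w) u') /\
  (C <> setT ->
     exists2 v, subgradient r u v & is_argmin C (model (g + v)) u').

Variables (g u u' : 'rV[R]_n).
Hypothesis upd : prox_update g u u'.

Lemma prox_update_feasible : C u'.
Proof.
case: upd => h1 h2; have [CT|CT] := pselect (C = setT); first by rewrite CT.
by have [v _ []] := h2 CT.
Qed.

(* The three-point inequality of the update, with a common form [phi] of the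
   linearized and the proximal models. *)
Lemma prox_update_model : exists phi : 'rV[R]_n -> R,
  [/\ forall w, C w -> phi u' + (2 * alpha)^-1 * enorm (u' - u) ^+ 2 +
        (2 * alpha)^-1 * enorm (w - u') ^+ 2 <=
        phi w + (2 * alpha)^-1 * enorm (w - u) ^+ 2,
      forall w t, 0 <= t -> t <= 1 -> C w ->
        dotv g (u' - w) + r u' - r w <=
        phi u' - phi w + 2 * lam * enorm (u' - ((1 - t) *: u + t *: w)) &
      forall w w', phi w - phi w' <= (enorm g + lam) * enorm (w - w')].
Proof.
have c0 : 0 < (2 * alpha)^-1 by rewrite invr_gt0 mulr_gt0.
have Cu' := prox_update_feasible.
case: upd => h1 h2; have [CT|CT] := pselect (C = setT).
  have [_ umin] := h1 CT; exists (fun w => dotv g w + r w); split.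
  - move=> w Cw.
    apply: (@prox_three_point _ _ C (fun w => dotv g w + r w) _ u u' w c0 Cu' Cw).
      move=> t t0 t1; split; first by rewrite CT.
      rewrite dotvDr !dotvZr; have := convex_functionE u' w cr t0 t1; lra.
    by move=> y _; have := umin y I; rewrite !dotvBr; lra.
  - move=> w t t0 t1 _; rewrite dotvBr.
    have := enorm_ge0 (u' - ((1 - t) *: u + t *: w)) => h.
    have : 0 <= 2 * lam * enorm (u' - ((1 - t) *: u + t *: w)) by rewrite !mulr_ge0.
    lra.
  - move=> w w'; have := lipschitz_le w w'; have := cauchy_schwarz_dotv g (w - w').
    rewrite dotvBr; lra.
have [v rv [_ umin]] := h2 CT; have vlam := subgradient_enorm rv.
exists (dotv (g + v)); split.
- move=> w Cw; apply: (@prox_three_point _ _ C (dotv (g + v)) _ u u' w c0 Cu' Cw).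
    move=> t t0 t1; split; first exact: convex_setE.
    by rewrite [dotv _ (_ + _)]dotvDr !dotvZr.
  by move=> y Cy; have := umin y Cy; rewrite ![dotv _ (_ - u)]dotvBr; lra.
(* Here phi holds the linearization of r, and r u' - r w must be compared with [dotv v (u' - w)].
   Both are routed through z: going from u' to z costs lam |u' - z| for r and as much for v, and
   between z and w convexity and the subgradient inequality at u suffice. *)
- move=> w t t0 t1 Cw; set z := (1 - t) *: u + t *: w.
  have rw : r u + dotv v (w - u) <= r w := rv w.
  have rz : r z <= (1 - t) * r u + t * r w := convex_functionE u w cr t0 t1.
  have ruz := lipschitz_le u' z.
  have vz := cauchy_schwarz_dotvN v (u' - z).
  have {}vz : - dotv v (u' - z) <= lam * enorm (u' - z).
    by apply: le_trans vz _; rewrite ler_wpM2r ?enorm_ge0.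
  have vE : dotv v (u' - z) = dotv v u' - dotv v w - (1 - t) * dotv v (u - w).
    by rewrite /z !dotvBr dotvDr !dotvZr; ring.
  have rw' : 0 <= (1 - t) * (r w - r u - dotv v (w - u)).
    by rewrite mulr_ge0//; lra.
  move: rw' vE vz; rewrite !dotvDl !dotvBr; lra.
- move=> w w'; rewrite -dotvBr (le_trans (cauchy_schwarz_dotv _ _))//.
  rewrite ler_wpM2r ?enorm_ge0//.
  by have := enormD g v; lra.
Qed.

Lemma prox_update_le w t : C w -> 0 <= t -> t <= 1 ->
  dotv g (u' - w) + r u' - r w <=
  (2 * alpha)^-1 *
    (enorm (u - w) ^+ 2 - enorm (u' - w) ^+ 2 - enorm (u' - u) ^+ 2) +
  2 * lam * enorm (u' - ((1 - t) *: u + t *: w)).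
Proof.
move=> Cw t0 t1; have [phi [tp gr _]] := prox_update_model.
have := tp w Cw; have := gr w t t0 t1 Cw; rewrite (enormBC w u') (enormBC w u); lra.
Qed.

(** Adding the three-point inequality at a to the obtuse angle inequality cancels the distances to u
    and leaves |u' - a|^2 / alpha <= phi a - phi u', whose right side is Lipschitz in |u' - a|. *)
Lemma prox_update_proj a : is_proj C u a ->
  enorm (u' - a) <= alpha * (enorm g + lam).
Proof.
move=> [pa ca]; have [phi [tp _ lp]] := prox_update_model.
have c0 : 0 < (2 * alpha)^-1 by rewrite invr_gt0 mulr_gt0.
have pu' := pa _ prox_update_feasible.
(* As a may lie outside C, the three-point inequality reaches it by approximation. The difference of
   the two squared distances is affine in w, so [K] is a Lipschitz constant for the whole
   inequality. *)
set K := (enorm g + lam) + 2 * (2 * alpha)^-1 * enorm (u' - u).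
have K0 : 0 <= K.
  by rewrite !addr_ge0 ?enorm_ge0 ?mulr_ge0 ?enorm_ge0// ltW.
have lim : phi u' + (2 * alpha)^-1 * enorm (u' - u) ^+ 2 +
    (2 * alpha)^-1 * enorm (a - u') ^+ 2 <=
    phi a + (2 * alpha)^-1 * enorm (a - u) ^+ 2.
  apply/ler_addgt0Pr => e e0.
  have e1 : 0 < e / (K + 1) by rewrite divr_gt0//; lra.
  have [w Cw wa] := ca _ e1.
  have h1 := tp w Cw; have h2 := lp w a.
  have h3 : K * enorm (w - a) <= e.
    have : (K + 1) * enorm (w - a) <= e by rewrite mulrC -ler_pdivlMr//; lra.
    by have := enorm_ge0 (w - a); lra.
  have h4 : enorm (w - u) ^+ 2 - enorm (w - u') ^+ 2 -
      (enorm (a - u) ^+ 2 - enorm (a - u') ^+ 2) = 2 * dotv (u' - u) (w - a).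
    rewrite !sqr_enormB !dotvBl !dotvBr.
    by rewrite (dotvC w u) (dotvC w u') (dotvC a u) (dotvC a u'); ring.
  have h5 := cauchy_schwarz_dotv (u' - u) (w - a).
  have h6 : (2 * alpha)^-1 * (2 * dotv (u' - u) (w - a)) <=
      2 * (2 * alpha)^-1 * enorm (u' - u) * enorm (w - a).
    by rewrite mulrCA -!mulrA ler_pM2l// ler_pM2l.
  have h7 : (2 * alpha)^-1 * (enorm (w - u) ^+ 2 - enorm (w - u') ^+ 2 -
      (enorm (a - u) ^+ 2 - enorm (a - u') ^+ 2)) =
      (2 * alpha)^-1 * (2 * dotv (u' - u) (w - a)) by rewrite h4.
  move: h3; rewrite /K mulrDl => h3; lra.
have [->|ua0] := eqVneq (enorm (u' - a)) 0.
  by rewrite mulr_ge0 ?addr_ge0 ?enorm_ge0// ltW.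
have {}ua0 : 0 < enorm (u' - a) by rewrite lt_neqAle eq_sym ua0 enorm_ge0.
have h2 := lp a u'.
have h3 : 2 * ((2 * alpha)^-1 * enorm (u' - a) ^+ 2) <=
    (enorm g + lam) * enorm (u' - a).
  have : (2 * alpha)^-1 * (enorm (a - u) ^+ 2 + enorm (u' - a) ^+ 2) <=
    (2 * alpha)^-1 * enorm (u' - u) ^+ 2 by rewrite ler_pM2l.
  by move: h2 lim; rewrite (enormBC a u'); lra.
rewrite -(ler_pM2r ua0).
have -> : enorm (u' - a) * enorm (u' - a) =
    alpha * (2 * ((2 * alpha)^-1 * enorm (u' - a) ^+ 2)) by field; rewrite gt_eqF.
by rewrite -mulrA ler_pM2l.
Qed.

End BlockStep.

(** * Projection on the closure of a convex set *)

Section Projection.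
Context {R : realType} {n : nat}.
Implicit Types u v c w : 'rV[R]_n.

Lemma continuous_enorm : continuous (@enorm R n).
Proof.
have cd : continuous (fun v : 'rV[R]_n => dotv v v).
  apply: (@continuous_big R 'I_n +%R 0 xpredT _ _ _
    (fun j (v : 'rV[R]_n) => v 0 j * v 0 j)); first exact: add_continuous.
  move=> j _ v; have cj : {for v, continuous (fun v : 'rV[R]_n => v 0 j : R)}.
    exact: coord_continuous.
  exact: (continuousM cj cj).
move=> v; apply: (continuous_comp (cd v)); exact: sqrt_continuous.
Qed.

Lemma continuous_enormB u : continuous (fun v => enorm (v - u)).
Proof.
move=> v; apply: (@continuous_comp _ _ _ (fun v => v - u) enorm).
  by apply: continuousB; [move=> ?; exact|exact: cst_continuous].
exact: continuous_enorm.
Qed.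

Lemma normr_le_enorm v : `|v| <= enorm v.
Proof.
rewrite /Num.Def.normr/= mx_normrE; apply/bigmax_leP; split; first exact: enorm_ge0.
move=> [i j] _ /=; rewrite ord1; apply: le_of_sqr; first exact: enorm_ge0.
rewrite real_normK ?num_real// sqr_enorm /dotv (bigD1 j)//= -expr2 lerDl.
by rewrite sumr_ge0// => k _; rewrite -expr2 sqr_ge0.
Qed.

Lemma is_proj_exists (C : set 'rV[R]_n) u : convex_set C -> C !=set0 ->
  exists a, is_proj C u a.
Proof.
move=> cC [w0 Cw0].
pose A := closure C `&` [set v | enorm (v - u) <= enorm (w0 - u)].
have [] := @EVT_min_rV R n (fun v => enorm (v - u)) A.
- by exists w0; split => /=; [exact: subset_closure|].
- apply: bounded_closed_compact.
    exists (enorm (w0 - u) + `|u|); split=> [|M hM v]; first exact: num_real.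
    move=> [_ /= vu].
    rewrite -[v](subrK u) (le_trans (ler_normD _ _))// (le_trans _ (ltW hM))//.
    by rewrite lerD2r (le_trans (normr_le_enorm _)).
  apply: closedI; first exact: closed_closure.
  have := @preimage_closed _ _ (fun v : 'rV[R]_n => enorm (v - u))
    [set y | y <= enorm (w0 - u)].
  apply; last exact: closed_le.
  by move=> v _; exact: continuous_enormB.
- by apply: continuous_subspaceT; exact: continuous_enormB.
move=> c; rewrite inE => -[clc /= cw0] cmin.
have adh e : 0 < e -> exists2 w, C w & enorm (w - c) <= e.
  move=> e0; have : nbhs c [set v | enorm (v - c) < e].
    have := @continuous_enormB c c [set y | y < e]; apply.
    by rewrite subrr enorm0; exact: lt_nbhsl.
  by move=> /clc [w [Cw /ltW we]]; exists w.
have cminC w : C w -> enorm (c - u) <= enorm (w - u).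
  move=> Cw; have [wu|/ltW] := leP (enorm (w - u)) (enorm (w0 - u)).
    by apply: cmin; rewrite inE; split => //; exact: subset_closure.
  exact: le_trans.
exists c; split=> // w Cw.
(* The minimizer c lies in the closure, but convexity is available in C: c is replaced by a point of
   C within e. *)
have cmint t : 0 < t -> t <= 1 -> enorm (c - u) <= enorm ((1 - t) *: c + t *: w - u).
  move=> t0 t1; apply/ler_addgt0Pr => e e0; have [c' Cc' cc'] := adh e e0.
  have := cminC _ (convex_setE cC Cc' Cw (ltW t0) t1).
  have -> : (1 - t) *: c' + t *: w - u =
      ((1 - t) *: c + t *: w - u) + (1 - t) *: (c' - c).
    by apply/rowP => j; rewrite !mxE; ring.
  move=> /le_trans; apply; apply: le_trans (enormD _ _) _.
  rewrite lerD2l enormZ ?subr_ge0//.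
  have : 0 <= t * enorm (c' - c) by rewrite mulr_ge0 ?enorm_ge0// ltW.
  lra.
rewrite -lerBrDl; apply: le_of_scaled_le; first exact: sqr_ge0.
move=> t t0 t1; have := cmint t t0 t1; rewrite -ler_sqr ?nnegrE ?enorm_ge0//.
rewrite (enormBC (_ + _) u) sqr_enorm_conv (enormBC u c) (enormBC u w) (enormBC c w).
by move=> h; rewrite -(ler_pM2l t0); lra.
Qed.

End Projection.

(** * Expectations of square-integrable vectors *)

Section IntegralMonotonicity.
Context {R : realType} {d : measure_display} {T : measurableType d}.
Variable mu : {measure set T -> \bar R}.

(* No measurability is required, which spares proving that [Phi] composed with
   the averaged iterate is measurable. *)
Lemma ge0_le_integral_nomeas (f g : T -> \bar R) :
  (forall w, 0 <= f w)%E -> (forall w, f w <= g w)%E ->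
  (\int[mu]_w f w <= \int[mu]_w g w)%E.
Proof.
move=> f0 fg; have g0 w : (0 <= g w)%E by exact: le_trans (fg w).
rewrite !ge0_integralTE//; apply: ereal_sup_le => _ [h /= hf <-].
by exists h => //= w; exact: le_trans (fg w).
Qed.

End IntegralMonotonicity.

Section RealExpectation.
Context {R : realType} {d : measure_display} {T : measurableType d}.
Variable P : probability T R.
Implicit Types (f g : T -> R).

Local Notation L1 f := (P.-integrable [set: T] (EFin \o f)).
Local Notation Ex f := (\int[P]_w f w).

Lemma L1_measurable f : L1 f -> measurable_fun setT f.
Proof. by move=> /(measurable_int P)/measurable_EFinP. Qed.

Lemma L1D f g : L1 f -> L1 g -> L1 (fun w => f w + g w).
Proof. by move=> Lf Lg; apply: eq_integrable (integrableD _ Lf Lg). Qed.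

Lemma L1Z c f : L1 f -> L1 (fun w => c * f w).
Proof. by move=> Lf; apply: eq_integrable (integrableZl _ c Lf). Qed.

Lemma L1N f : L1 f -> L1 (fun w => - f w).
Proof. by move=> Lf; apply: eq_integrable (integrableN Lf). Qed.

Lemma L1B f g : L1 f -> L1 g -> L1 (fun w => f w - g w).
Proof. by move=> Lf Lg; apply: L1D => //; exact: L1N. Qed.

Lemma L1_cst c : L1 (fun _ : T => c).
Proof. exact: finite_measure_integrable_cst. Qed.

Lemma L1_sum I (s : seq I) (h : I -> T -> R) : (forall i, L1 (h i)) ->
  L1 (fun w => \sum_(i <- s) h i w).
Proof.
move=> Lh; apply: eq_integrable (integrable_sum _ s (P := xpredT) (fun i _ => Lh i)) => //.
by move=> w _ /=; rewrite sumEFin.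
Qed.

Lemma L1_ae_le f g : measurable_fun setT f -> L1 g ->
  {ae P, forall w, `|f w| <= g w} -> L1 f.
Proof.
move=> mf Lg fg; apply/integrableP; split; first exact/measurable_EFinP.
move/integrableP : (Lg) => [mg]; apply: le_lt_trans.
apply: ae_ge0_le_integral => //.
- by apply: measurableT_comp => //; exact/measurable_EFinP.
- by apply: measurableT_comp.
apply: filterS fg => w fgw _; rewrite lee_fin (le_trans fgw)//; exact: ler_norm.
Qed.

Lemma L1_le f g : measurable_fun setT f -> L1 g ->
  (forall w, `|f w| <= g w) -> L1 f.
Proof. by move=> mf Lg fg; apply: (L1_ae_le mf Lg); exact: aeW. Qed.

Lemma ExD f g : L1 f -> L1 g -> Ex (fun w => f w + g w) = Ex f + Ex g.
Proof. by move=> Lf Lg; rewrite RintegralD. Qed.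

Lemma ExB f g : L1 f -> L1 g -> Ex (fun w => f w - g w) = Ex f - Ex g.
Proof. by move=> Lf Lg; rewrite RintegralB. Qed.

Lemma ExZ c f : L1 f -> Ex (fun w => c * f w) = c * Ex f.
Proof. by move=> Lf; rewrite RintegralZl. Qed.

Lemma ExN f : L1 f -> Ex (fun w => - f w) = - Ex f.
Proof. by move=> Lf; under eq_Rintegral do rewrite -mulN1r; rewrite ExZ// mulN1r. Qed.

Lemma Ex_cst c : Ex (fun=> c) = c.
Proof.
rewrite Rintegral_cst//; have /= -> := @probability_setT _ _ _ P.
by rewrite mulr1.
Qed.

Lemma Ex_sum I (s : seq I) (h : I -> T -> R) : (forall i, L1 (h i)) ->
  Ex (fun w => \sum_(i <- s) h i w) = \sum_(i <- s) Ex (h i).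
Proof.
move=> Lh; elim: s => [|i s IH].
  by under eq_Rintegral do rewrite big_nil; rewrite Ex_cst big_nil.
under eq_Rintegral do rewrite big_cons.
by rewrite ExD ?big_cons ?IH//; exact: L1_sum.
Qed.

Lemma le_Ex f g : L1 f -> L1 g -> (forall w, f w <= g w) -> Ex f <= Ex g.
Proof. by move=> Lf Lg fg; apply: le_Rintegral. Qed.

Lemma Ex_ge0 f : (forall w, 0 <= f w) -> 0 <= Ex f.
Proof. by move=> f0; exact: Rintegral_ge0. Qed.

Lemma Ex_ge0_ae f : L1 f -> {ae P, forall w, 0 <= f w} -> 0 <= Ex f.
Proof.
move=> Lf f0; have mf := L1_measurable Lf.
rewrite /Rintegral (ae_eq_integral (fun w => (Num.max (f w) 0)%:E))//.
- by apply: Rintegral_ge0 => w _; rewrite le_max lexx orbT.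
- exact/measurable_EFinP.
- by apply/measurable_EFinP; apply: measurable_maxr.
- by apply: filterS f0 => w fw _; rewrite max_l.
Qed.

Lemma Ex_fineE f : L1 f -> (\int[P]_w (f w)%:E = (Ex f)%:E)%E.
Proof. by move=> Lf; rewrite /Rintegral fineK//; exact: integrable_fin_num. Qed.

Lemma le_expectation f g : (forall w, 0 <= f w) -> (forall w, f w <= g w) ->
  L1 g -> ('E_P[f] <= (Ex g)%:E)%E.
Proof.
move=> f0 fg Lg; rewrite unlock -Ex_fineE//; apply: ge0_le_integral_nomeas => w.
  by rewrite lee_fin.
by rewrite lee_fin.
Qed.

Lemma expectation_le_L1 f c : measurable_fun setT f -> (forall w, 0 <= f w) ->
  ('E_P[f] <= c%:E)%E -> L1 f /\ Ex f <= c.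
Proof.
move=> mf f0; rewrite unlock => fc.
have Lf : L1 f.
  apply/integrableP; split; first exact/measurable_EFinP.
  under eq_integral do rewrite /= ger0_norm//.
  exact: le_lt_trans fc (ltry _).
by split => //; rewrite -lee_fin -Ex_fineE.
Qed.

Definition L2 f := measurable_fun setT f /\ L1 (fun w => f w ^+ 2).

Lemma L2M f g : L2 f -> L2 g -> L1 (fun w => f w * g w).
Proof.
move=> [mf Lf] [mg Lg]; apply: (L1_le (g := fun w => f w ^+ 2 + g w ^+ 2)).
- exact: measurable_funM.
- exact: L1D.
- move=> w; rewrite ler_norml.
  have := sqr_ge0 (f w + g w); have := sqr_ge0 (f w - g w).
  have := sqr_ge0 (f w); have := sqr_ge0 (g w) => *.
  by apply/andP; split; lra.
Qed.

Lemma L2_cst c : L2 (fun _ : T => c).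
Proof. by split; [exact: measurable_cst|exact: L1_cst]. Qed.

Lemma L2_L1 f : L2 f -> L1 f.
Proof.
move=> Lf; apply: eq_integrable (L2M Lf (L2_cst 1)) => //.
by move=> w _ /=; rewrite mulr1.
Qed.

Lemma L2D f g : L2 f -> L2 g -> L2 (fun w => f w + g w).
Proof.
move=> Lf Lg; have [mf Lf2] := Lf; have [mg Lg2] := Lg.
split; first exact: measurable_funD.
have := L1D (L1D Lf2 (L1Z 2 (L2M Lf Lg))) Lg2; apply: eq_integrable => //.
by move=> w _ /=; congr EFin; ring.
Qed.

Lemma L2Z c f : L2 f -> L2 (fun w => c * f w).
Proof.
move=> [mf Lf]; split; first exact: measurable_funM.
by have := L1Z (c ^+ 2) Lf; apply: eq_integrable => // w _ /=; rewrite exprMn.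
Qed.

Lemma cauchy_schwarz_Ex f g : L2 f -> L2 g ->
  Ex (fun w => f w * g w) <=
  Num.sqrt (Ex (fun w => f w ^+ 2)) * Num.sqrt (Ex (fun w => g w ^+ 2)).
Proof.
move=> Lf Lg; have Lfg := L2M Lf Lg.
set a := Ex (fun w => f w ^+ 2); set b := Ex (fun w => g w ^+ 2).
set c := Ex (fun w => f w * g w).
have a0 : 0 <= a by apply: Ex_ge0 => w; exact: sqr_ge0.
have b0 : 0 <= b by apply: Ex_ge0 => w; exact: sqr_ge0.
have q t u : 0 <= t ^+ 2 * a - 2 * t * u * c + u ^+ 2 * b.
  have := Ex_ge0 (fun w => sqr_ge0 (t * f w - u * g w)).
  have -> : Ex (fun w => (t * f w - u * g w) ^+ 2) =
      Ex (fun w => (t ^+ 2 * f w ^+ 2 - 2 * t * u * (f w * g w)) + u ^+ 2 * g w ^+ 2).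
    by apply: eq_Rintegral => w _; ring.
  case: Lf Lg => [_ Lf] [_ Lg].
  have L1 := L1Z (t ^+ 2) Lf; have L2 := L1Z (2 * t * u) Lfg.
  have L3 := L1Z (u ^+ 2) Lg.
  by rewrite (ExD (L1B L1 L2) L3) (ExB L1 L2) !ExZ.
have [c0|c0] := ltP c 0; first by apply: le_trans (ltW c0) _; rewrite mulr_ge0 ?sqrtr_ge0.
apply: le_of_sqr; first by rewrite mulr_ge0 ?sqrtr_ge0.
rewrite exprMn !sqr_sqrtr//.
have [b0'|b0'] := eqVneq b 0.
  have [->|cn0] := eqVneq c 0; first by rewrite expr0n mulr_ge0.
  have cp : 0 < c by rewrite lt_neqAle eq_sym cn0.
  (* When b = 0 the form is affine in its second argument, and this value makes it -1. *)
  have := q 1 ((a + 1) / (2 * c)); rewrite b0' mulr0 addr0.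
  have -> : 1 ^+ 2 * a - 2 * 1 * ((a + 1) / (2 * c)) * c = -1.
    by field.
  lra.
have bp : 0 < b by rewrite lt_neqAle eq_sym b0'.
by have h := q b c; rewrite -(ler_pM2r bp); lra.
Qed.

End RealExpectation.

Section SquareIntegrableVectors.
Context {R : realType} {d : measure_display} {T : measurableType d}.
Variable P : probability T R.

Local Notation L1 f := (P.-integrable [set: T] (EFin \o f)).
Local Notation L2 := (L2 P).
Local Notation Ex f := (\int[P]_w f w).

Section Fixed.
Context {n : nat}.
Implicit Types u v : T -> 'rV[R]_n.

Definition L2v v := forall j, L2 (fun w => v w 0 j).

(** The norm of L^2(P; R^n). *)
Definition rms v : R := Num.sqrt (Ex (fun w => enorm (v w) ^+ 2)).

Lemma L2v_cst (c : 'rV[R]_n) : L2v (fun=> c).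
Proof. by move=> j; exact: L2_cst. Qed.

Lemma L2vD u v : L2v u -> L2v v -> L2v (fun w => u w + v w).
Proof.
move=> Lu Lv j; have := L2D (Lu j) (Lv j).
by under [in X in _ -> X]eq_fun do rewrite mxE.
Qed.

Lemma L2vZ c v : L2v v -> L2v (fun w => c *: v w).
Proof.
by move=> Lv j; have := L2Z c (Lv j); under [in X in _ -> X]eq_fun do rewrite mxE.
Qed.

Lemma L2vB u v : L2v u -> L2v v -> L2v (fun w => u w - v w).
Proof.
move=> Lu Lv; have := L2vD Lu (L2vZ (-1) Lv).
by under [in X in X -> _]eq_fun do rewrite scaleN1r.
Qed.

Lemma L1_dotv u v : L2v u -> L2v v -> L1 (fun w => dotv (u w) (v w)).
Proof. by move=> Lu Lv; apply: L1_sum => j; exact: L2M. Qed.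

Lemma measurable_enorm v : (forall j, measurable_fun setT (fun w => v w 0 j)) ->
  measurable_fun setT (fun w => enorm (v w)).
Proof.
move=> mv; have ms : measurable_fun setT (@Num.sqrt R).
  by apply: continuous_measurable_fun; exact: sqrt_continuous.
apply: (measurableT_comp ms).
by apply: measurable_sum => j; exact: measurable_funM.
Qed.

Lemma L2_enorm v : L2v v -> L2 (fun w => enorm (v w)).
Proof.
move=> Lv; split; first by apply: measurable_enorm => j; exact: (Lv j).1.
by have := L1_dotv Lv Lv; under [in X in _ -> X]eq_fun do rewrite sqr_enorm.
Qed.

Lemma L1_sqr_enorm v : L2v v -> L1 (fun w => enorm (v w) ^+ 2).
Proof. by move/L2_enorm => []. Qed.

Lemma L2v_of_enorm v : (forall j, measurable_fun setT (fun w => v w 0 j)) ->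
  L1 (fun w => enorm (v w) ^+ 2) -> L2v v.
Proof.
move=> mv Lv j; split => //; apply: (L1_le _ Lv); first exact: measurable_funX.
move=> w; rewrite ger0_norm ?sqr_ge0// sqr_enorm /dotv (bigD1 j)//= -expr2 lerDl.
by rewrite sumr_ge0// => k _; rewrite -expr2 sqr_ge0.
Qed.

Lemma rms_ge0 v : 0 <= rms v.
Proof. exact: sqrtr_ge0. Qed.

Lemma sqr_rms v : rms v ^+ 2 = Ex (fun w => enorm (v w) ^+ 2).
Proof. by rewrite sqr_sqrtr// Ex_ge0// => w; exact: sqr_ge0. Qed.

Lemma rms_cst (c : 'rV[R]_n) : rms (fun=> c) = enorm c.
Proof. by rewrite /rms Ex_cst sqrtr_sqr ger0_norm// enorm_ge0. Qed.

Lemma le_rms u v :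
  L1 (fun w => enorm (u w) ^+ 2) -> L2v v ->
  (forall w, enorm (u w) <= enorm (v w)) -> rms u <= rms v.
Proof.
move=> Lu Lv uv; rewrite ler_wsqrtr// le_Ex//; first exact: L1_sqr_enorm.
by move=> w; rewrite ler_sqr ?nnegrE ?enorm_ge0.
Qed.

Lemma Ex_enorm_le v : L2v v -> Ex (fun w => enorm (v w)) <= rms v.
Proof.
move=> Lv; have := cauchy_schwarz_Ex (L2_enorm Lv) (L2_cst P 1).
rewrite expr1n Ex_cst sqrtr1 mulr1.
by under [in X in X -> _]eq_Rintegral do rewrite mulr1.
Qed.

Lemma Ex_enormM_le u v : L2v u -> L2v v ->
  Ex (fun w => enorm (u w) * enorm (v w)) <= rms u * rms v.
Proof. by move=> Lu Lv; apply: cauchy_schwarz_Ex; exact: L2_enorm. Qed.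

Lemma rmsD u v : L2v u -> L2v v -> rms (fun w => u w + v w) <= rms u + rms v.
Proof.
move=> Lu Lv; apply: le_of_sqr; first by rewrite addr_ge0 ?rms_ge0.
have Luv := L2M (L2_enorm Lu) (L2_enorm Lv).
have L := L1D (L1D (L1_sqr_enorm Lu) (L1Z 2 Luv)) (L1_sqr_enorm Lv).
rewrite sqr_rms; apply: le_trans (le_Ex (L1_sqr_enorm (L2vD Lu Lv)) L _) _.
  by move=> w; rewrite sqr_enormD; have := cauchy_schwarz_dotv (u w) (v w); lra.
have := Ex_enormM_le Lu Lv.
rewrite (ExD (L1D (L1_sqr_enorm Lu) (L1Z 2 Luv)) (L1_sqr_enorm Lv)).
rewrite (ExD (L1_sqr_enorm Lu) (L1Z 2 Luv)) (ExZ 2 Luv).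
by rewrite sqrrD !sqr_rms; lra.
Qed.

Lemma rmsZ c v : L2v v -> 0 <= c -> rms (fun w => c *: v w) = c * rms v.
Proof.
move=> Lv c0; rewrite /rms; under eq_Rintegral do rewrite sqr_enormZ.
by rewrite (ExZ _ (L1_sqr_enorm Lv)) sqrtrM ?sqr_ge0// sqrtr_sqr ger0_norm.
Qed.

Lemma rmsB u v : L2v u -> L2v v -> rms (fun w => u w - v w) <= rms u + rms v.
Proof.
move=> Lu Lv; have := rmsD Lu (L2vZ (-1) Lv).
rewrite {3}/rms; under [in X in X -> _]eq_Rintegral do
  rewrite sqr_enormZ sqrrN expr1n mul1r.
by rewrite /rms; under [in X in X -> _]eq_Rintegral do rewrite scaleN1r.
Qed.

End Fixed.

Section BlocksL2.
Context {s : nat} {n : 'I_s -> nat}.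

Lemma L2v_submxrow (v : T -> 'rV[R]_(\sum_(i < s) n i)) i :
  L2v v -> L2v (fun w => submxrow (v w) i).
Proof. by move=> Lv j; under eq_fun do rewrite mxE; exact: Lv. Qed.

Lemma L2v_mxrow (v : forall i, T -> 'rV[R]_(n i)) : (forall i, L2v (v i)) ->
  L2v (fun w => \mxrow_i v i w).
Proof. by move=> Lv j; under eq_fun do rewrite mxE; exact: Lv. Qed.

End BlocksL2.

End SquareIntegrableVectors.

(** * Conditional bias against vectors determined by the past *)

Section ConditionalExpectation.
Context {R : realType} {d : measure_display} {T : measurableType d}.
Variable P : probability T R.

Local Notation L1 f := (P.-integrable [set: T] (EFin \o f)).
Local Notation Ex f := (\int[P]_w f w).

Variable G : set (set T).
Hypothesis mG : <<s G >> `<=` measurable.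
Local Notation TG := (g_sigma_algebraType G).

Import HBNNSimple.

Lemma sub_measurable_fun (Z : T -> R) :
  measurable_fun [set: TG] (Z : TG -> R) -> measurable_fun setT Z.
Proof.
by move=> mZ _ B mB; have := mZ measurableT B mB; rewrite !setTI => /mG.
Qed.

(** Z is the increasing limit of simple functions measurable for the generated sigma-algebra. For
    these the product with h integrates to 0 level set by level set, and |Z h| dominates the passage
    to the limit. *)
Lemma Ex_mul_eq0_ge0 (h Z : T -> R) : L1 h ->
  (forall B, <<s G >> B -> (\int[P]_(w in B) (h w)%:E = 0)%E) ->
  measurable_fun [set: TG] (Z : TG -> R) -> (forall w, 0 <= Z w) ->
  L1 (fun w => Z w * h w) -> (\int[P]_w (Z w * h w)%:E = 0)%E.
Proof.
move=> Lh h0 mZ Z0 LZh; have mh := L1_measurable Lh.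
have mZe : measurable_fun [set: TG] (EFin \o (Z : TG -> R)).
  exact/measurable_EFinP.
pose g := nnsfun_approx measurableT mZe.
have gZ w : g ^~ w @ \oo --> Z w.
  have := @cvg_nnsfun_approx _ _ _ _ measurableT _ mZe (fun w _ => Z0 w) w I.
  by move/fine_cvg.
have gle k w : g k w <= Z w.
  rewrite /g nnsfun_approxE -lee_fin.
  exact: (@le_approx _ TG R setT (EFin \o Z) k w (fun w _ => Z0 w) I).
have Lind B : <<s G >> B -> L1 (fun w => \1_B w * h w).
  move=> GB; apply: (L1_le _ (integrable_norm Lh)).
    by apply: measurable_funM => //; exact/measurable_indic/mG.
  move=> w; rewrite normrM ler_piMl ?normr_ge0// ger0_norm// indicE.
have mB k y : <<s G >> (g k @^-1` [set y]).
  exact: (@measurable_funPTI _ _ TG _ (g k) [set y] (measurable_set1 y)).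
have gE k w : g k w * h w = \sum_(y <- finmap.enum_fset (fset_set (range (g k))))
    (y * (\1_(g k @^-1` [set y]) w * h w)).
  rewrite fimfunE fsbig_finite//= mulr_suml.
  by apply: eq_bigr => y _; rewrite mulrA.
have Lyh k y : L1 (fun w => y * (\1_(g k @^-1` [set y]) w * h w)).
  by apply: L1Z; exact: Lind.
have Lgh k : L1 (fun w => g k w * h w).
  by under eq_fun do rewrite gE; exact: L1_sum.
have Eg k : (\int[P]_w (g k w * h w)%:E = 0)%E.
  rewrite Ex_fineE//; congr EFin; under eq_Rintegral do rewrite gE.
  rewrite Ex_sum// big1// => y _; rewrite ExZ; last exact: Lind.
  rewrite [X in _ * X](_ : _ = 0) ?mulr0// /Rintegral.
  rewrite -[RHS](_ : fine 0%E = 0)// -(h0 _ (mB k y)) [in RHS]integral_mkcond.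
  congr fine; apply: eq_integral => w _; rewrite patchE/= indicE.
  by case: ifPn => _; rewrite ?mul1r ?mul0r.
have [| | | | |_ _] := @dominated_convergence _ _ _ P setT measurableT
  (fun k w => (g k w * h w)%:E) (fun w => (Z w * h w)%:E) (fun w => `|Z w * h w|%:E).
- by move=> k; exact: (measurable_int P (Lgh k)).
- exact: (measurable_int P LZh).
- apply: aeW => w _; apply: cvg_EFin.
    by apply: nearW => k.
  by apply: cvgMl; exact: gZ.
- exact: integrable_norm LZh.
- apply: aeW => w k _ /=; rewrite lee_fin !normrM ler_wpM2r ?normr_ge0//.
  by rewrite !ger0_norm//; exact: fun_ge0.
move=> /(cvg_lim (@ereal_hausdorff R)) <-.
by under eq_fun do rewrite Eg; exact: lim_cst.
Qed.

Lemma Ex_mul_eq0 (h Z : T -> R) : L1 h ->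
  (forall B, <<s G >> B -> (\int[P]_(w in B) (h w)%:E = 0)%E) ->
  measurable_fun [set: TG] (Z : TG -> R) ->
  L1 (fun w => Z w * h w) -> Ex (fun w => Z w * h w) = 0.
Proof.
move=> Lh h0 mZ LZh.
have mzh := L1_measurable Lh; have mZT := sub_measurable_fun mZ.
pose Zp w := Num.max (Z w) 0; pose Zn w := Num.max (- Z w) 0.
have mZp : measurable_fun [set: TG] (Zp : TG -> R).
  by apply: measurable_maxr => //; exact: measurable_cst.
have mZn : measurable_fun [set: TG] (Zn : TG -> R).
  by apply: measurable_maxr; [exact: measurableT_comp|exact: measurable_cst].
have ZE w : Z w = Zp w - Zn w.
  rewrite /Zp /Zn; case/orP: (le_total 0 (Z w)) => z.
    by rewrite max_l// max_r ?oppr_le0// subr0.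
  by rewrite max_r// max_l ?oppr_ge0// sub0r opprK.
have LA : L1 (fun w => `|Z w * h w|) by exact: integrable_norm.
have Lp : L1 (fun w => Zp w * h w).
  apply: (L1_le _ LA); first exact/measurable_funM/mzh/sub_measurable_fun.
  move=> w; rewrite !normrM ler_wpM2r ?normr_ge0// /Zp.
  case/orP: (le_total 0 (Z w)) => z; first by rewrite max_l.
  by rewrite max_r// normr0 normr_ge0.
have Ln : L1 (fun w => Zn w * h w).
  apply: (L1_le _ LA); first exact/measurable_funM/mzh/sub_measurable_fun.
  move=> w; rewrite !normrM ler_wpM2r ?normr_ge0// /Zn.
  case/orP: (le_total 0 (Z w)) => z.
    by rewrite max_r ?oppr_le0// normr0 normr_ge0.
  by rewrite max_l ?oppr_ge0// normrN.
under eq_Rintegral do rewrite ZE mulrBl.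
rewrite ExB// /Rintegral !Ex_mul_eq0_ge0 ?subrr// => w.
  by rewrite le_max lexx orbT.
by rewrite le_max lexx orbT.
Qed.

(** Z is measurable with respect to G, so [delta] may be replaced by its conditional expectation Y
    inside the expectation; then Cauchy-Schwarz is applied pointwise. *)
Lemma cond_exp_dotv_le n (delta Y Z : T -> 'rV[R]_n) (c : R) :
  is_cond_exp_vec P G delta Y -> {ae P, forall w, enorm (Y w) <= c} ->
  (forall j, measurable_fun [set: TG] ((fun w => Z w 0 j) : TG -> R)) ->
  L2v P Z -> L2v P delta ->
  - Ex (fun w => dotv (delta w) (Z w)) <= c * Ex (fun w => enorm (Z w)).
Proof.
move=> dY Yc mZ LZ Ld.
(* Square integrability of Y is not given; its almost sure bound c makes the product integrable. *)
have LYZ j : L1 (fun w => Z w 0 j * Y w 0 j).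
  have [_ _ LY _] := dY j.
  apply: (L1_ae_le _ (L1Z c (L2_L1 (L2_enorm LZ)))).
    by apply: measurable_funM; [exact: (LZ j).1|exact: L1_measurable LY].
  apply: filterS Yc => w Yc; rewrite normrM mulrC ler_pM ?normr_ge0//.
    apply: le_trans Yc; apply: le_of_sqr; first exact: enorm_ge0.
    rewrite real_normK ?num_real// sqr_enorm /dotv (bigD1 j)//= -expr2 lerDl.
    by rewrite sumr_ge0// => k _; rewrite -expr2 sqr_ge0.
  apply: le_of_sqr; first exact: enorm_ge0.
  rewrite real_normK ?num_real// sqr_enorm /dotv (bigD1 j)//= -expr2 lerDl.
  by rewrite sumr_ge0// => k _; rewrite -expr2 sqr_ge0.
have eqj j : Ex (fun w => Z w 0 j * delta w 0 j) = Ex (fun w => Z w 0 j * Y w 0 j).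
  have [Ldj mY LY dYB] := dY j.
  have LZd := L2M (LZ j) (Ld j).
  apply/eqP; rewrite -subr_eq0 -ExB//; apply/eqP.
  under eq_Rintegral do rewrite -mulrBr.
  apply: Ex_mul_eq0 => //.
  - exact: L1B.
  - move=> B GB; have mB := mG GB.
    rewrite (_ : (fun w => _) = (fun w => (delta w 0 j)%:E - (Y w 0 j)%:E)%E)//.
    rewrite integralB//; [|exact: integrableS Ldj|exact: integrableS LY].
    by rewrite dYB// subee// integrable_fin_num//; exact: integrableS Ldj.
  - by have := L1B LZd (LYZ j); under [in X in _ -> X]eq_fun do rewrite mulrBr.
have LYd : L1 (fun w => dotv (Z w) (Y w)) by apply: L1_sum.
have -> : Ex (fun w => dotv (delta w) (Z w)) = Ex (fun w => dotv (Z w) (Y w)).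
  rewrite !Ex_sum// => [|j]; last exact: L2M.
  by apply: eq_bigr => j _; rewrite -eqj; under eq_Rintegral do rewrite mulrC.
have LcZ := L1Z c (L2_L1 (L2_enorm LZ)).
rewrite -ExZ; last exact: L2_L1 (L2_enorm LZ).
rewrite -subr_ge0 opprK -ExD//; apply: Ex_ge0_ae; first exact: L1D.
apply: filterS Yc => w Yc; have := cauchy_schwarz_dotvN (Z w) (Y w).
have : enorm (Y w) * enorm (Z w) <= c * enorm (Z w) by rewrite ler_wpM2r ?enorm_ge0.
lra.
Qed.

End ConditionalExpectation.

(** * One sweep over all blocks, for a fixed outcome *)

Section FullStep.
Context {R : realType} {s : nat} {n : 'I_s -> nat}.
Local Notation point := 'rV[R]_(\sum_(i < s) n i).
Implicit Types (x y z xnew xold : point).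

Lemma enorm_gs_point_sub xnew xold i :
  enorm (xnew - gs_point xnew xold i) <= enorm (xnew - xold).
Proof.
apply: enorm_blocks_le => j; rewrite !submxrowB mxrowK; case: ifP => // _.
by rewrite subrr enorm0 enorm_ge0.
Qed.

Lemma sqr_enorm_gs_point xnew xold i :
  enorm (gs_point xnew xold i) ^+ 2 <= enorm xold ^+ 2 + enorm xnew ^+ 2.
Proof.
rewrite !sqr_enorm_blocks -big_split/=; apply: ler_sum => j _; rewrite mxrowK.
by case: ifP => _; rewrite ?lerDl ?lerDr sqr_ge0.
Qed.

Variables (F : point -> R) (L : R).
Hypothesis cF : convex_function setT F.
Hypothesis dF : forall x, differentiable F x.
Hypothesis L0 : 0 <= L.
Hypothesis FL : forall i x y,
  enorm (pgrad F i x - pgrad F i y) <= L * enorm (x - y).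
Variables (r : forall i, 'rV[R]_(n i) -> R) (X : forall i, set 'rV[R]_(n i)).
Variables (lam : 'I_s -> R) (lmax alpha : R).
Hypothesis cX : forall i, convex_set (@X i).
Hypothesis cr : forall i, convex_function setT (@r i).
Hypothesis lam0 : forall i, 0 <= lam i.
Hypothesis lmax0 : 0 <= lmax.
Hypothesis lam_le : forall i, lam i <= lmax.
Hypothesis rL : forall i u v, `|@r i u - @r i v| <= lam i * enorm (u - v).
Hypothesis alpha0 : 0 < alpha.
Variables (x xn : point) (g : forall i, 'rV[R]_(n i)).
Hypothesis upd : forall i,
  prox_update (@X i) (@r i) alpha (g i) (submxrow x i) (submxrow xn i).

Let err : point := \mxrow_i (g i - pgrad F i (gs_point xn x i)).

(** The block inequalities are summed. The blocks interact only through [hT]: the point where block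
    i takes its gradient differs from [xn] only in blocks still to be updated, hence by at most |xn
    - x|. *)
Lemma full_step_le xstar t : feasible X xstar -> 0 <= t -> t <= 1 ->
  alpha * (composite F r xn - composite F r xstar) <=
  (enorm (x - xstar) ^+ 2 - enorm (xn - xstar) ^+ 2 - enorm (xn - x) ^+ 2) / 2 +
  2 * alpha * lmax * Num.sqrt s%:R *
    enorm (xn - ((1 - t) *: x + t *: xstar)) -
  alpha * dotv err (xn - xstar) +
  alpha * L * Num.sqrt s%:R * (enorm (xn - x) * enorm (xn - xstar)).
Proof.
move=> Xstar t0 t1.
set z := (1 - t) *: x + t *: xstar.
have hF : F xn - F xstar <= dotv (grad F xn) (xn - xstar).
  have := convex_gradient_le xstar cF (dF xn).
  by rewrite -opprB dotvNr; lra.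
have hT : \sum_(i < s) dotv (pgrad F i xn - pgrad F i (gs_point xn x i))
      (submxrow (xn - xstar) i) <=
    L * Num.sqrt s%:R * (enorm (xn - x) * enorm (xn - xstar)).
  apply: (@le_trans _ _ (\sum_(i < s) L * enorm (xn - x) *
      enorm (submxrow (xn - xstar) i))).
    apply: ler_sum => i _; apply: le_trans (cauchy_schwarz_dotv _ _) _.
    rewrite ler_wpM2r ?enorm_ge0//; apply: le_trans (FL _ _ _) _.
    by rewrite ler_wpM2l// enorm_gs_point_sub.
  rewrite -mulr_sumr.
  have -> : L * Num.sqrt s%:R * (enorm (xn - x) * enorm (xn - xstar)) =
    L * enorm (xn - x) * (Num.sqrt s%:R * enorm (xn - xstar)) by ring.
  by rewrite ler_wpM2l ?mulr_ge0 ?enorm_ge0// sum_enorm_blocks.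
have hB : \sum_(i < s) (dotv (g i) (submxrow (xn - xstar) i) +
      r (submxrow xn i) - r (submxrow xstar i)) <=
    (2 * alpha)^-1 * (enorm (x - xstar) ^+ 2 - enorm (xn - xstar) ^+ 2 -
      enorm (xn - x) ^+ 2) + 2 * lmax * (Num.sqrt s%:R * enorm (xn - z)).
  apply: (@le_trans _ _ (\sum_(i < s) ((2 * alpha)^-1 *
      (enorm (submxrow (x - xstar) i) ^+ 2 - enorm (submxrow (xn - xstar) i) ^+ 2
        - enorm (submxrow (xn - x) i) ^+ 2) +
      2 * lmax * enorm (submxrow (xn - z) i)))).
    apply: ler_sum => i _.
    have := prox_update_le (@cX i) (@cr i) (lam0 i) alpha0 (@rL i) (upd i)
      (Xstar i) t0 t1.
    have -> : submxrow xn i - ((1 - t) *: submxrow x i + t *: submxrow xstar i) =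
        submxrow (xn - z) i by apply/rowP => j; rewrite !mxE.
    have : 2 * lam i * enorm (submxrow (xn - z) i) <=
        2 * lmax * enorm (submxrow (xn - z) i).
      by rewrite ler_wpM2r ?enorm_ge0// ler_pM2l.
    by rewrite -!submxrowB; lra.
  rewrite big_split/= -!mulr_sumr !sumrB -!sqr_enorm_blocks lerD2l.
  by rewrite ler_wpM2l ?sum_enorm_blocks// mulr_ge0.
have -> : composite F r xn - composite F r xstar =
    (F xn - F xstar) + \sum_(i < s) (r (submxrow xn i) - r (submxrow xstar i)).
  by rewrite /composite sumrB; ring.
have gE : dotv (grad F xn) (xn - xstar) =
    \sum_(i < s) dotv (pgrad F i xn - pgrad F i (gs_point xn x i))
      (submxrow (xn - xstar) i) +
    \sum_(i < s) dotv (g i) (submxrow (xn - xstar) i) - dotv err (xn - xstar).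
  rewrite !dotv_blocks -big_split/= -sumrB; apply: eq_bigr => i _.
  by rewrite mxrowK !dotvBl; ring.
have : alpha * (F xn - F xstar +
    \sum_(i < s) (r (submxrow xn i) - r (submxrow xstar i))) <=
  alpha * (L * Num.sqrt s%:R * (enorm (xn - x) * enorm (xn - xstar)) +
    ((2 * alpha)^-1 * (enorm (x - xstar) ^+ 2 - enorm (xn - xstar) ^+ 2 -
      enorm (xn - x) ^+ 2) + 2 * lmax * (Num.sqrt s%:R * enorm (xn - z))) -
    dotv err (xn - xstar)).
  rewrite ler_pM2l//; move: hB; rewrite 2!big_split/= !sumrN sumrB; lra.
have -> : alpha * (L * Num.sqrt s%:R * (enorm (xn - x) * enorm (xn - xstar)) +
    ((2 * alpha)^-1 * (enorm (x - xstar) ^+ 2 - enorm (xn - xstar) ^+ 2 -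
      enorm (xn - x) ^+ 2) + 2 * lmax * (Num.sqrt s%:R * enorm (xn - z))) -
    dotv err (xn - xstar)) =
  (enorm (x - xstar) ^+ 2 - enorm (xn - xstar) ^+ 2 - enorm (xn - x) ^+ 2) / 2 +
  2 * alpha * lmax * Num.sqrt s%:R * enorm (xn - z) -
  alpha * dotv err (xn - xstar) +
  alpha * L * Num.sqrt s%:R * (enorm (xn - x) * enorm (xn - xstar)).
  by field; rewrite gt_eqF.
by [].
Qed.

(** Origin of [M_rho]: in each block (|e| + |G| + l)^2 <= 4 |e|^2 + 4 |G|^2 + 2 l^2, and |G|^2 <= 2
    L^2 |y|^2 + 2 |g0|^2 with y the mixed point and g0 the partial gradient at 0. *)
Lemma full_step_proj (a : point) :
  (forall i, is_proj (@X i) (submxrow x i) (submxrow a i)) ->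
  enorm (xn - a) ^+ 2 <= alpha ^+ 2 *
    (8 * L ^+ 2 * s%:R * (enorm x ^+ 2 + enorm xn ^+ 2) +
     4 * enorm err ^+ 2 +
     \sum_(i < s) (8 * enorm (pgrad F i 0) ^+ 2 + 2 * lam i ^+ 2)).
Proof.
move=> pa.
have -> : 8 * L ^+ 2 * s%:R * (enorm x ^+ 2 + enorm xn ^+ 2) =
    \sum_(i < s) 8 * L ^+ 2 * (enorm x ^+ 2 + enorm xn ^+ 2).
  by rewrite sumr_const card_ord -mulr_natr; ring.
rewrite (sqr_enorm_blocks err) (sqr_enorm_blocks (xn - a)).
rewrite [4 * _]mulr_sumr -!big_split/= mulr_sumr; apply: ler_sum => i _.
rewrite mxrowK submxrowB.
set G := pgrad F i (gs_point xn x i); set e := g i - G.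
have h1 := prox_update_proj (@cX i) (@cr i) (lam0 i) alpha0 (@rL i) (upd i) (pa i).
have h2 : enorm (g i) <= enorm e + enorm G.
  by have := enormD e G; rewrite subrK.
have h3 : enorm G <= L * enorm (gs_point xn x i) + enorm (pgrad F i 0).
  rewrite -{1}(subrK (pgrad F i 0) G); apply: le_trans (enormD _ _) _.
  by rewrite lerD2r -[gs_point xn x i in leRHS]subr0; exact: FL.
have h4 := sqr_enorm_gs_point xn x i.
have := enorm_ge0 e; have := enorm_ge0 G; have := enorm_ge0 (pgrad F i 0).
have := enorm_ge0 (gs_point xn x i); have := lam0 i; have := enorm_ge0 (g i).
move: h1 h2 h3 h4.
move: (enorm e) (enorm G) (enorm (pgrad F i 0)) (enorm (gs_point xn x i)) (lam i)
  (enorm (g i)) (enorm x) (enorm xn) => ee gg g0 y l gi X0 X1.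
move=> h1 h2 h3 h4 gi0 l0 y0 g00 gg0 ee0.
have h5 : (gi + l) ^+ 2 <= (ee + gg + l) ^+ 2 by rewrite ler_sqr ?nnegrE; lra.
have h6 : (ee + gg + l) ^+ 2 <= 4 * ee ^+ 2 + 4 * gg ^+ 2 + 2 * l ^+ 2.
  by have := sqr_ge0 (ee - gg); have := sqr_ge0 (ee + gg - l); nra.
have h7 : gg ^+ 2 <= (L * y + g0) ^+ 2.
  by rewrite ler_sqr ?nnegrE//; have := mulr_ge0 L0 y0; lra.
have h8 : (L * y + g0) ^+ 2 <= 2 * L ^+ 2 * y ^+ 2 + 2 * g0 ^+ 2.
  by have := sqr_ge0 (L * y - g0); nra.
have h9 : L ^+ 2 * y ^+ 2 <= L ^+ 2 * (X0 ^+ 2 + X1 ^+ 2).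
  by rewrite ler_wpM2l ?sqr_ge0.
apply: (@le_trans _ _ ((alpha * (gi + l)) ^+ 2)).
  rewrite ler_sqr ?nnegrE ?enorm_ge0//.
  by rewrite mulr_ge0 ?addr_ge0// ltW.
by rewrite exprMn ler_pM2l ?exprn_gt0//; lra.
Qed.

End FullStep.

(** * Sums of step sizes *)

Section StepSizeSums.
Context {R : realType}.

Lemma le_invr_lnB (k : nat) : (0 < k)%N ->
  k.+1%:R^-1 <= ln k.+1%:R - ln k%:R :> R.
Proof.
move=> k0; have kp : 0 < k%:R :> R by rewrite ltr0n.
have kp1 : 0 < k.+1%:R :> R by rewrite ltr0n.
have : ln (1 + - k.+1%:R^-1) <= - k.+1%:R^-1 :> R.
  by apply: le_ln1Dx; rewrite ltrN2 invf_lt1// ltr1n ltnS.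
have -> : 1 + - k.+1%:R^-1 = k%:R / k.+1%:R :> R.
  by rewrite -natr1; field; rewrite natr1 gt_eqF.
by rewrite ln_div ?posrE// -lerN2 opprK opprB.
Qed.

Lemma harmonic_le_ln (K : nat) : (0 < K)%N ->
  \sum_(1 <= k < K.+1) k%:R^-1 <= 1 + ln K%:R :> R.
Proof.
elim: K => // -[_ _|K IH _]; first by rewrite big_nat1 invr1 ln1 addr0.
rewrite big_nat_recr//=; apply: le_trans (lerD (IH isT) (@le_invr_lnB K.+1 isT)) _.
by rewrite -addrA lerD2l addrC subrK.
Qed.

(** 1/4 + 1/5 + 1/6 <= ln 6 - ln 3. *)
Lemma ln2_ge : 37 / 60 <= ln 2 :> R.
Proof.
have := @le_invr_lnB 3 isT; have := @le_invr_lnB 4 isT; have := @le_invr_lnB 5 isT.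
have -> : (6 : R) = 2 * 3 by ring.
rewrite lnM ?posrE//; lra.
Qed.

(** The increment of the left side is sqrt (K + 2) - sqrt (K + 1) <= 1 / sqrt (K + 1). The induction
    can start at 3, where 1 + 1 / sqrt 2 + 1 / sqrt 3 exceeds 2. *)
Lemma sqrt_sum_ge (K : nat) : (3 <= K)%N ->
  Num.sqrt (1 + K%:R) <= \sum_(1 <= k < K.+1) (Num.sqrt k%:R)^-1 :> R.
Proof.
elim: K => // K IH; rewrite leq_eqVlt => /orP[/eqP<-|K3].
  rewrite big_nat_recr//= big_nat_recr//= big_nat1 sqrtr1 invr1.
  have s4 : Num.sqrt (1 + 3) = 2 :> R.
    by rewrite (_ : 1 + 3 = 2 ^+ 2) ?sqrtr_sqr ?ger0_norm//; ring.
  rewrite s4.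
  have a0 : 0 < Num.sqrt 2 :> R by rewrite sqrtr_gt0.
  have a2 : Num.sqrt 2 ^+ 2 = 2 :> R by rewrite sqr_sqrtr.
  have b0 : 0 < Num.sqrt 3 :> R by rewrite sqrtr_gt0.
  have b2 : Num.sqrt 3 ^+ 2 = 3 :> R by rewrite sqr_sqrtr.
  have a1 : 1 / 2 <= (Num.sqrt 2)^-1 :> R.
    by rewrite -[leLHS]invrK lef_pV2 ?posrE//; nra.
  have b1 : 1 / 2 <= (Num.sqrt 3)^-1 :> R.
    by rewrite -[leLHS]invrK lef_pV2 ?posrE//; nra.
  lra.
rewrite big_nat_recr//=; apply: le_trans (lerD (IH K3) (lexx _)).
set a := Num.sqrt _; set b := Num.sqrt (1 + K%:R); set c := Num.sqrt _.
have aE : a ^+ 2 = K%:R + 2 by rewrite sqr_sqrtr ?addr_ge0// -natr1; ring.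
have bE : b ^+ 2 = K%:R + 1 by rewrite sqr_sqrtr ?addr_ge0//; ring.
have cE : c = b by rewrite /c /b -natr1 addrC.
have b0 : 0 < b by rewrite sqrtr_gt0; have := ler0n R K; lra.
have a0 : 0 <= a := sqrtr_ge0 _.
rewrite cE -(ler_pM2r b0) mulrDl mulVf ?gt_eqF//.
have : 0 <= (a - b) ^+ 2 := sqr_ge0 _.
nra.
Qed.

Lemma final_bound1 (D q theta : R) : 0 <= D -> 0 < theta ->
  theta^-1 * (7 / 10 * (theta ^+ 2 * D + q ^+ 2 / 2)) <=
  D * theta * ((1 + ln 1) / Num.sqrt (1 + 1)) +
    q ^+ 2 / (2 * theta * Num.sqrt (1 + 1)).
Proof.
move=> D0 t0; set a : R := Num.sqrt (1 + 1).
have a0 : 0 < a by rewrite sqrtr_gt0.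
have a2 : a ^+ 2 = 2 by rewrite sqr_sqrtr; lra.
have a1 : 7 / 10 <= a^-1.
  by rewrite -[leLHS]invrK lef_pV2 ?posrE//; nra.
rewrite ln1 addr0 mul1r.
have -> : theta^-1 * (7 / 10 * (theta ^+ 2 * D + q ^+ 2 / 2)) =
    7 / 10 * (D * theta + q ^+ 2 / (2 * theta)) by field; rewrite gt_eqF.
have -> : D * theta * a^-1 + q ^+ 2 / (2 * theta * a) =
    a^-1 * (D * theta + q ^+ 2 / (2 * theta)) by field; rewrite !gt_eqF.
have q0 : 0 <= q ^+ 2 / (2 * theta).
  by rewrite divr_ge0 ?sqr_ge0// mulr_ge0// ltW.
by rewrite ler_wpM2r// addr_ge0// mulr_ge0// ltW.
Qed.

(* Since [1 + 1 / sqrt 2 < sqrt 3], the plain telescoped bound is not enough for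
   two iterations; the constants [65 / 132] and [26 / 25] come from keeping a
   fraction of the squared moves. *)
Lemma final_bound2 (D q theta : R) : 0 <= D -> 0 < theta ->
  (theta + theta / Num.sqrt 2)^-1 *
    (65 / 132 * q ^+ 2 + 26 / 25 * (theta ^+ 2 + theta ^+ 2 / 2) * D) <=
  D * theta * ((1 + ln 2) / Num.sqrt (1 + 2)) +
    q ^+ 2 / (2 * theta * Num.sqrt (1 + 2)).
Proof.
move=> D0 t0; set a : R := Num.sqrt 2; set b : R := Num.sqrt (1 + 2).
have a0 : 0 < a by rewrite sqrtr_gt0.
have a2 : a ^+ 2 = 2 by rewrite sqr_sqrtr.
have b0 : 0 < b by rewrite sqrtr_gt0; lra.
have b2 : b ^+ 2 = 3 by rewrite sqr_sqrtr; lra.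
have aV : a^-1 = a / 2.
  by rewrite -a2; field; rewrite gt_eqF.
have -> : (theta + theta / a)^-1 *
    (65 / 132 * q ^+ 2 + 26 / 25 * (theta ^+ 2 + theta ^+ 2 / 2) * D) =
  (1 + a / 2)^-1 * (65 / 66 * (q ^+ 2 / (2 * theta)) + 39 / 25 * (D * theta)).
  by rewrite aV; field; rewrite -mulrDr mulf_neq0 !gt_eqF//; lra.
have -> : D * theta * ((1 + ln 2) / b) + q ^+ 2 / (2 * theta * b) =
  b^-1 * ((q ^+ 2 / (2 * theta)) + (1 + ln 2) * (D * theta)).
  by field; rewrite !gt_eqF.
have q0 : 0 <= q ^+ 2 / (2 * theta).
  by rewrite divr_ge0 ?sqr_ge0// mulr_ge0// ltW.
have Dt0 : 0 <= D * theta by rewrite mulr_ge0// ltW.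
have ap : 0 < 1 + a / 2 by rewrite addr_gt0// divr_gt0.
move: q0 Dt0; move: (q ^+ 2 / (2 * theta)) (D * theta) => Q DD Q0 DD0.
rewrite ler_pdivrMl// [leRHS]mulrCA ler_pdivlMl//.
(* Continued fraction convergents of sqrt 2 and sqrt 3. The margin in [h1] is below 1 / 500, so
   coarser ones may fail; 97 / 60 below is 1 + 37 / 60. *)
have a1 : 41 / 29 <= a by apply: le_of_sqr; rewrite ?a2 ?ltW//; lra.
have b1 : b <= 97 / 56 by apply: le_of_sqr; rewrite ?b2//; lra.
have h1 : b * (65 / 66) <= 1 + a / 2 by clear - a1 b1; lra.
have h2 : b * (39 / 25) <= (1 + a / 2) * (1 + ln 2).
  apply: (@le_trans _ _ ((1 + a / 2) * (97 / 60))); first by clear - a1 b1; lra.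
  by apply: ler_wpM2l; [exact: ltW|have := @ln2_ge; lra].
by have := ler_wpM2r Q0 h1; have := ler_wpM2r DD0 h2; lra.
Qed.

Lemma final_bound3 (D q theta : R) (K : nat) : 0 <= D -> 0 < theta -> (3 <= K)%N ->
  (\sum_(1 <= k < K.+1) theta / Num.sqrt k%:R)^-1 *
    (q ^+ 2 / 2 + D * \sum_(1 <= k < K.+1) (theta / Num.sqrt k%:R) ^+ 2) <=
  D * theta * ((1 + ln K%:R) / Num.sqrt (1 + K%:R)) +
    q ^+ 2 / (2 * theta * Num.sqrt (1 + K%:R)).
Proof.
move=> D0 t0 K3; set b := Num.sqrt (1 + K%:R).
have b0 : 0 < b by rewrite sqrtr_gt0; have := ler0n R K; lra.
have hb := sqrt_sum_ge K3; rewrite -/b in hb.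
have hh := @harmonic_le_ln K (leq_trans _ K3).
rewrite -mulr_sumr.
have -> : \sum_(1 <= k < K.+1) (theta / Num.sqrt k%:R) ^+ 2 =
    theta ^+ 2 * \sum_(1 <= k < K.+1) k%:R^-1.
  rewrite mulr_sumr; apply: eq_bigr => k _.
  by rewrite exprMn exprVn sqr_sqrtr.
have sb : (theta * \sum_(1 <= k < K.+1) (Num.sqrt k%:R)^-1)^-1 <= (theta * b)^-1.
  rewrite lef_pV2 ?posrE ?mulr_gt0//; first by rewrite ler_pM2l.
  exact: lt_le_trans hb.
have h0 : 0 <= \sum_(1 <= k < K.+1) k%:R^-1 :> R.
  by apply: sumr_ge0 => k _; rewrite invr_ge0.
apply: (@le_trans _ _ ((theta * b)^-1 *
   (q ^+ 2 / 2 + D * (theta ^+ 2 * \sum_(1 <= k < K.+1) k%:R^-1)))).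
  rewrite ler_wpM2r// addr_ge0//; first by rewrite divr_ge0 ?sqr_ge0.
  by rewrite mulr_ge0// mulr_ge0// sqr_ge0.
have -> : D * theta * ((1 + ln K%:R) / b) + q ^+ 2 / (2 * theta * b) =
  (theta * b)^-1 * (q ^+ 2 / 2 + D * (theta ^+ 2 * (1 + ln K%:R))).
  by field; rewrite !gt_eqF.
rewrite ler_pM2l ?invr_gt0 ?mulr_gt0// lerD2l ler_wpM2l// ler_wpM2l ?sqr_ge0//.
exact: hh.
Qed.

End StepSizeSums.

(** * A run of the method *)

Section Run.
Context {R : realType} {d d' : measure_display}.
Context {T : measurableType d} {S : measurableType d'}.
Variable P : probability T R.
Context {s : nat} {n : 'I_s -> nat}.
Local Notation point := 'rV[R]_(\sum_(i < s) n i).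
Variables (f : point -> S -> R) (xi0 : {RV P >-> S}).
Variables (r : forall i, 'rV[R]_(n i) -> R) (X : forall i, set 'rV[R]_(n i)).
Variables (m : nat -> nat) (xi : nat -> nat -> {RV P >-> S}).
Variables (L theta A rho sig : R) (sigma : nat -> R) (Lr : 'I_s -> R).
Variables (x1 xstar : point).
Variables (iters : set nat) (alpha : nat -> R) (x : nat -> T -> point).
Variable K : nat.

Local Notation L1 f := (P.-integrable [set: T] (EFin \o f)).
Local Notation Ex f := (\int[P]_w f w).
Local Notation F := (exp_obj P f xi0).
Local Notation Phi := (composite F r).
Local Notation rms := (rms P).
Local Notation L2v := (L2v P).

Hypothesis s_gt0 : (0 < s)%N.
Hypothesis cX : forall i, convex_set (@X i).
Hypothesis dF : forall y, differentiable F y.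
Hypothesis theta_gt0 : 0 < theta.
Hypothesis L_gt0 : 0 < L.
Hypothesis theta_lt : theta < L^-1.
Hypothesis rho_ge0 : 0 <= rho.
Hypothesis FL : forall i y z,
  enorm (pgrad F i y - pgrad F i z) <= L * enorm (y - z).
Hypothesis rL : forall i u v, `|@r i u - @r i v| <= Lr i * enorm (u - v).
Hypothesis cF : convex_function setT F.
Hypothesis cr : forall i, convex_function setT (@r i).
Hypothesis xstar_min : is_argmin (feasible X) Phi xstar.
Hypothesis run : bsg_run f r X m xi iters (fun=> alpha) x x1.
Hypothesis noise : grad_error_bound f xi0 m xi iters (fun=> alpha) x A sigma.
Hypothesis xbound : iterates_bound P iters x rho.
Hypothesis itersK : forall k, (1 <= k <= K)%N -> iters k.
Hypothesis alpha_gt0 : forall k, (1 <= k <= K)%N -> 0 < alpha k.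
Hypothesis sigma_ge0 : forall k, 0 <= sigma k.
Hypothesis sigma_le : forall k, (1 <= k <= K)%N -> sigma k <= sig.
Hypothesis K_gt0 : (0 < K)%N.

(* [Lr i] may be negative when the block [i] has size [0]. *)
Let lam i := Num.max (Lr i) 0.
Let lmax := \big[Num.max/0]_(i < s) Lr i.
Let rad := enorm xstar + rho.
Let sqs : R := Num.sqrt s%:R.
Let D := D_const F L theta A rho sig Lr xstar.
Let Yc := Num.sqrt (\sum_(j < s) (4 * M_rho F L rho ^+ 2 + 4 * sig ^+ 2 +
  2 * Lr j ^+ 2)).

Lemma sig_ge0 : 0 <= sig.
Proof. by apply: le_trans (sigma_ge0 1) (sigma_le _); rewrite K_gt0. Qed.

Lemma rad_ge0 : 0 <= rad.
Proof. by rewrite addr_ge0 ?enorm_ge0. Qed.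

Lemma sqs_ge0 : 0 <= sqs.
Proof. exact: sqrtr_ge0. Qed.

Lemma sqr_sqs : sqs ^+ 2 = s%:R.
Proof. by rewrite sqr_sqrtr. Qed.

Lemma lam_ge0 i : 0 <= lam i.
Proof. by rewrite le_max lexx orbT. Qed.

Lemma lam_lmax i : lam i <= lmax.
Proof.
rewrite ge_max; apply/andP; split; first exact: le_bigmax.
exact: bigmax_ge_id.
Qed.

Lemma lmax_ge0 : 0 <= lmax.
Proof. exact: bigmax_ge_id. Qed.

Lemma sqr_lam i : lam i ^+ 2 <= Lr i ^+ 2.
Proof.
by rewrite /lam; case: (leP (Lr i) 0) => _; rewrite ?expr0n ?sqr_ge0.
Qed.

Lemma rlam i u v : `|@r i u - @r i v| <= lam i * enorm (u - v).
Proof.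
apply: le_trans (rL u v) _; rewrite ler_wpM2r ?enorm_ge0//.
by rewrite le_max lexx.
Qed.

Lemma sub_batch_events k : <<s batch_events m xi k >> `<=` measurable.
Proof.
apply: smallest_sub; first exact: sigma_algebra_measurable.
move=> _ [j [l [B [_ _ mB ->]]]]; exact: measurable_funPTI.
Qed.

Lemma x_adapted k j : (1 <= k <= K.+1)%N ->
  measurable_fun [set: g_sigma_algebraType (batch_events m xi k.-1)]
    ((fun w => x k w 0 j) : g_sigma_algebraType (batch_events m xi k.-1) -> R).
Proof.
case: k => // -[_|k /andP[_ kK]].
  have [x1E _ _] := run; under eq_fun do rewrite x1E; exact: measurable_cst.
by have [_ _ mx] := run; apply: mx; apply: itersK.
Qed.

Lemma x_measurable k j : (1 <= k <= K.+1)%N ->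
  measurable_fun setT (fun w => x k w 0 j).
Proof.
move=> hk; apply: (sub_measurable_fun (@sub_batch_events k.-1)).
exact: x_adapted.
Qed.

Lemma x_L2 k : (1 <= k <= K.+1)%N -> L2v (x k) /\ rms (x k) <= rho.
Proof.
move=> hk.
have E : ('E_P[fun w => (enorm (x k w) ^+ 2)%R] <= (rho ^+ 2)%:E)%E.
  (* The iterate of index K + 1 is produced but starts no iteration of a stopped run: its bound is
     the second half of [iterates_bound] at K. *)
  case: k hk => // k /andP[_]; rewrite ltnS leq_eqVlt => /orP[/eqP->|kK].
    by have [] := xbound (itersK (k := K) _); rewrite ?K_gt0 ?leqnn.
  by have [] := xbound (itersK (k := k.+1) kK).
have me : measurable_fun setT (fun w => enorm (x k w) ^+ 2).
  by apply: measurable_funX; apply: measurable_enorm => j; exact: x_measurable.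
have [Lx Ex_le] := expectation_le_L1 me (fun w => sqr_ge0 _) E.
split; first by apply: L2v_of_enorm => // j; exact: x_measurable.
by apply: le_of_sqr => //; rewrite sqr_rms.
Qed.

Let err k w : point := \mxrow_i grad_error f xi0 m xi x k i w.

Lemma err_L2 k : (1 <= k <= K)%N -> L2v (err k) /\ rms (err k) <= sqs * sig.
Proof.
move=> hk; have Li i : L2v (grad_error f xi0 m xi x k i) /\
    Ex (fun w => enorm (grad_error f xi0 m xi x k i w) ^+ 2) <= sig ^+ 2.
  have [[Y dY _] E] := noise i (itersK hk).
  have mi j : measurable_fun setT (fun w => grad_error f xi0 m xi x k i w 0 j).
    by have [/L1_measurable] := dY j.
  have me : measurable_fun setT
      (fun w => enorm (grad_error f xi0 m xi x k i w) ^+ 2).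
    by apply: measurable_funX; exact: measurable_enorm.
  have [Lx Ex_le] := expectation_le_L1 me (fun w => sqr_ge0 _) E.
  split; first exact: L2v_of_enorm.
  by apply: le_trans Ex_le _; rewrite lerXn2r ?nnegrE ?sigma_ge0 ?sig_ge0 ?sigma_le.
split; first by apply: L2v_mxrow => i; exact: (Li i).1.
apply: le_of_sqr; first by rewrite mulr_ge0 ?sqs_ge0 ?sig_ge0.
rewrite sqr_rms exprMn sqr_sqs.
under eq_Rintegral do rewrite sqr_enorm_blocks.
rewrite Ex_sum => [|i]; last first.
  by under eq_fun do rewrite mxrowK; exact: L1_sqr_enorm (Li i).1.
apply: (@le_trans _ _ (\sum_(i < s) sig ^+ 2)).
  by apply: ler_sum => i _; under eq_Rintegral do rewrite mxrowK; exact: (Li i).2.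
by rewrite sumr_const card_ord mulr_natl.
Qed.

(** The noise hypothesis forces the sign: a nonnegative norm is almost surely at most A times a
    positive step size. *)
Lemma A_ge0 : 0 <= A.
Proof.
have K1 : (1 <= 1 <= K)%N by rewrite K_gt0.
pose i0 := Ordinal s_gt0.
have [[Y _ Yb] _] := noise i0 (itersK K1).
have a0 : 0 < \big[Num.max/0]_(j < s) alpha 1%N.
  by rewrite (lt_le_trans (alpha_gt0 K1))//; exact: (le_bigmax _ _ i0).
rewrite -(pmulr_lge0 _ a0) -(Ex_cst P (A * _)).
apply: Ex_ge0_ae; first exact: L1_cst.
by apply: filterS Yb => w; exact: le_trans (enorm_ge0 _).
Qed.

Lemma bigmax_alpha k : (1 <= k <= K)%N ->
  \big[Num.max/0]_(j < s) alpha k = alpha k.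
Proof.
move=> /alpha_gt0/ltW a0; apply: le_anti; apply/andP; split.
  by apply/bigmax_leP; split=> [|j _]; rewrite ?lexx.
exact: (le_bigmax _ _ (Ordinal s_gt0)).
Qed.

Lemma bias k (Z : T -> point) : (1 <= k <= K)%N -> L2v Z ->
  (forall j, measurable_fun [set: g_sigma_algebraType (batch_events m xi k.-1)]
    ((fun w => Z w 0 j) : g_sigma_algebraType (batch_events m xi k.-1) -> R)) ->
  - Ex (fun w => dotv (err k w) (Z w)) <= A * alpha k * (sqs * rms Z).
Proof.
move=> hk LZ mZ; have [Le _] := err_L2 hk.
have LZi i := @L2v_submxrow _ _ _ _ _ _ _ i LZ.
have Lei i := @L2v_submxrow _ _ _ _ _ _ _ i Le.
under eq_Rintegral do rewrite dotv_blocks.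
rewrite Ex_sum => [|i]; last exact: L1_dotv.
rewrite -sumrN; have a0 := alpha_gt0 hk.
apply: (@le_trans _ _ (\sum_(i < s) A * alpha k *
    Ex (fun w => enorm (submxrow (Z w) i)))).
  apply: ler_sum => i _; have [[Y dY Yb] _] := noise i (itersK hk).
  rewrite bigmax_alpha// in Yb.
  apply: (cond_exp_dotv_le (@sub_batch_events k.-1) _ Yb) => //.
    by under eq_fun do rewrite mxrowK.
  by move=> j; under eq_fun do rewrite mxE; exact: mZ.
rewrite -mulr_sumr ler_wpM2l ?mulr_ge0 ?A_ge0 ?(ltW a0)//.
rewrite -Ex_sum => [|i]; last exact: L2_L1 (L2_enorm (LZi i)).
apply: (@le_trans _ _ (sqs * Ex (fun w => enorm (Z w)))).
  have LeZ := L2_L1 (L2_enorm LZ).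
  rewrite -ExZ//; apply: le_Ex; [|exact: L1Z|by move=> w; exact: sum_enorm_blocks].
  by apply: L1_sum => i; exact: L2_L1 (L2_enorm (LZi i)).
by rewrite ler_wpM2l ?sqs_ge0// Ex_enorm_le.
Qed.


(* The value [t = 0] serves in general and [t = 1 / 2] when [K = 1]. *)
Definition step_majorant k t w : R :=
  (enorm (x k w - xstar) ^+ 2 - enorm (x k.+1 w - xstar) ^+ 2 -
    enorm (x k.+1 w - x k w) ^+ 2) / 2 +
  2 * alpha k * lmax * sqs *
    enorm (x k.+1 w - ((1 - t) *: x k w + t *: xstar)) -
  alpha k * dotv (err k w) (x k.+1 w - xstar) +
  alpha k * L * sqs * (enorm (x k.+1 w - x k w) * enorm (x k.+1 w - xstar)).

Definition dist k := rms (fun w => x k w - xstar).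

Definition move_size k := rms (fun w => x k.+1 w - x k w).

Lemma run_update k i w : (1 <= k <= K)%N ->
  prox_update (@X i) (@r i) (alpha k) (stoch_grad f m xi x k i w)
    (submxrow (x k w) i) (submxrow (x k.+1 w) i).
Proof. by move=> hk; have [_ upd _] := run; have := upd k i w (itersK hk). Qed.

Lemma run_feasible k w : (1 <= k <= K)%N -> feasible X (x k.+1 w).
Proof. by move=> hk i; exact: prox_update_feasible (run_update i w hk). Qed.

Lemma le_step_majorant k t w : (1 <= k <= K)%N -> 0 <= t -> t <= 1 ->
  alpha k * (Phi (x k.+1 w) - Phi xstar) <= step_majorant k t w.
Proof.
move=> hk t0 t1; have [Xstar _] := xstar_min.
exact: (full_step_le cF dF (ltW L_gt0) FL cX cr lam_ge0 lmax_ge0 lam_lmax rlam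
  (alpha_gt0 hk) (fun i => run_update i w hk) Xstar t0 t1).
Qed.

Section OneStep.
Variable k : nat.
Hypothesis hk : (1 <= k <= K)%N.

Let hk1 : (1 <= k <= K.+1)%N.
Proof. by case/andP: hk => -> kK; rewrite leqW. Qed.

Let hkS : (1 <= k.+1 <= K.+1)%N.
Proof. by case/andP: hk => _; rewrite ltnS. Qed.

Let a0 : 0 < alpha k := alpha_gt0 hk.
Let Lx : L2v (x k) := (x_L2 hk1).1.
Let Lxn : L2v (x k.+1) := (x_L2 hkS).1.
Let Le : L2v (err k) := (err_L2 hk).1.
Let Lcst : L2v (fun=> xstar) := L2v_cst P xstar.
Let Lxs : L2v (fun w => x k w - xstar) := L2vB Lx Lcst.
Let Lxns : L2v (fun w => x k.+1 w - xstar) := L2vB Lxn Lcst.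
Let Lxx : L2v (fun w => x k.+1 w - x k w) := L2vB Lxn Lx.

Let Lz t : L2v (fun w => x k.+1 w - ((1 - t) *: x k w + t *: xstar)).
Proof. by apply: L2vB => //; apply: L2vD; apply: L2vZ. Qed.

Lemma L1_step_majorant t : L1 (step_majorant k t).
Proof.
apply: L1D; last by apply: L1Z; apply: L2M; exact: L2_enorm.
apply: L1B; last by apply: L1Z; exact: L1_dotv.
apply: L1D; last by apply: L1Z; exact: L2_L1 (L2_enorm (Lz t)).
have := L1Z 2^-1 (L1B (L1B (L1_sqr_enorm Lxs) (L1_sqr_enorm Lxns)) (L1_sqr_enorm Lxx)).
by under [in X in X -> _]eq_fun do rewrite mulrC.
Qed.

(** The noise term is split at a, which the earlier batches determine. Cauchy-Schwarz bounds the
    part that sees the current batch; [bias] bounds the other and gains a second factor alpha_k. *)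
Lemma Ex_step_majorant_le t (a : T -> point) : L2v a ->
  (forall j, measurable_fun [set: g_sigma_algebraType (batch_events m xi k.-1)]
    ((fun w => a w 0 j) : g_sigma_algebraType (batch_events m xi k.-1) -> R)) ->
  Ex (step_majorant k t) <=
  (dist k ^+ 2 - dist k.+1 ^+ 2 - move_size k ^+ 2) / 2 +
  2 * (alpha k * sqs * lmax) *
    rms (fun w => x k.+1 w - ((1 - t) *: x k w + t *: xstar)) +
  (alpha k * sqs * sig) * rms (fun w => x k.+1 w - a w) +
  alpha k ^+ 2 * A * sqs * rms (fun w => a w - xstar) +
  (alpha k * L * sqs) * move_size k * dist k.+1.
Proof.
move=> La ma.
have Lxa := L2vB Lxn La; have Las := L2vB La Lcst.
have LA := L1B (L1B (L1_sqr_enorm Lxs) (L1_sqr_enorm Lxns)) (L1_sqr_enorm Lxx).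
have LB := L2_L1 (L2_enorm (Lz t)).
have LC := L1_dotv Le Lxns.
have LE := L2M (L2_enorm Lxx) (L2_enorm Lxns).
have e1 : Ex (step_majorant k t) =
    2^-1 * (Ex (fun w => enorm (x k w - xstar) ^+ 2) -
      Ex (fun w => enorm (x k.+1 w - xstar) ^+ 2) -
      Ex (fun w => enorm (x k.+1 w - x k w) ^+ 2)) +
    2 * alpha k * lmax * sqs * Ex (fun w =>
      enorm (x k.+1 w - ((1 - t) *: x k w + t *: xstar))) -
    alpha k * Ex (fun w => dotv (err k w) (x k.+1 w - xstar)) +
    alpha k * L * sqs * Ex (fun w =>
      enorm (x k.+1 w - x k w) * enorm (x k.+1 w - xstar)).
  rewrite -(ExB (L1_sqr_enorm Lxs) (L1_sqr_enorm Lxns)).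
  rewrite -(ExB (L1B (L1_sqr_enorm Lxs) (L1_sqr_enorm Lxns)) (L1_sqr_enorm Lxx)).
  rewrite -(ExZ _ LA) -(ExZ _ LB) -(ExZ _ LC) -(ExZ _ LE).
  have L1' := L1Z 2^-1 LA; have L2' := L1Z (2 * alpha k * lmax * sqs) LB.
  have L3' := L1Z (alpha k) LC; have L4' := L1Z (alpha k * L * sqs) LE.
  rewrite -(ExD L1' L2') -(ExB (L1D L1' L2') L3').
  rewrite -(ExD (L1B (L1D L1' L2') L3') L4').
  by apply: eq_Rintegral => w _; rewrite /step_majorant; ring.
have e2 : - Ex (fun w => dotv (err k w) (x k.+1 w - xstar)) <=
    sqs * sig * rms (fun w => x k.+1 w - a w) +
    A * alpha k * (sqs * rms (fun w => a w - xstar)).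
  have -> : Ex (fun w => dotv (err k w) (x k.+1 w - xstar)) =
      Ex (fun w => dotv (err k w) (x k.+1 w - a w)) +
      Ex (fun w => dotv (err k w) (a w - xstar)).
    rewrite -(ExD (L1_dotv Le Lxa) (L1_dotv Le Las)).
    by apply: eq_Rintegral => w _; rewrite -dotvDr addrA subrK.
  rewrite opprD; apply: lerD.
    rewrite -(ExN (L1_dotv Le Lxa)).
    apply: le_trans (le_Ex (L1N (L1_dotv Le Lxa))
      (L2M (L2_enorm Le) (L2_enorm Lxa)) _) _.
      by move=> w; exact: cauchy_schwarz_dotvN.
    apply: le_trans (Ex_enormM_le Le Lxa) _.
    by rewrite ler_wpM2r ?rms_ge0//; exact: (err_L2 hk).2.
  apply: bias => // j; under eq_fun do rewrite !mxE.
  by apply: measurable_funB => //; exact: measurable_cst.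
exact: (combine_step_terms e1 (sqr_rms P _) (sqr_rms P _) (sqr_rms P _) (ltW a0)
  (ltW L_gt0) sqs_ge0 lmax_ge0 (Ex_enorm_le (Lz t)) e2 (Ex_enormM_le Lxx Lxns)).
Qed.

Lemma dist_le j : (1 <= j <= K.+1)%N ->
  dist j <= rad.
Proof.
move=> hj; have [Lj xr] := x_L2 hj.
apply: le_trans (rmsB Lj Lcst) _; rewrite rms_cst addrC.
by rewrite lerD2l.
Qed.

Lemma move_size_le : move_size k <= 2 * rho.
Proof.
apply: le_trans (rmsB Lxn Lx) _; rewrite mulr_natl mulr2n.
exact: lerD (x_L2 hkS).2 (x_L2 hk1).2.
Qed.

Lemma sqr_Yc : Yc ^+ 2 =
  s%:R * (4 * M_rho F L rho ^+ 2 + 4 * sig ^+ 2) + 2 * \sum_(i < s) Lr i ^+ 2.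
Proof.
rewrite sqr_sqrtr; last first.
  by apply: sumr_ge0 => j _; rewrite !addr_ge0 ?(sqr_ge0, mulr_ge0).
by rewrite big_split/= sumr_const card_ord -mulr_sumr (mulr_natl _ s).
Qed.

Lemma sqr_M_rho : M_rho F L rho ^+ 2 = 4 * L ^+ 2 * rho ^+ 2 +
  2 * \big[Num.max/0]_(i < s) enorm (pgrad F i 0) ^+ 2.
Proof.
by rewrite sqr_sqrtr// addr_ge0 ?(sqr_ge0, mulr_ge0)//; exact: bigmax_ge_id.
Qed.

Lemma rms_sub_proj_le (a : T -> point) : L2v a ->
  (forall w i, is_proj (@X i) (submxrow (x k w) i) (submxrow (a w) i)) ->
  rms (fun w => x k.+1 w - a w) <= alpha k * Yc.
Proof.
move=> La pa; have Lxa := L2vB Lxn La.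
apply: le_of_sqr; first by rewrite mulr_ge0 ?sqrtr_ge0// ltW.
rewrite sqr_rms exprMn sqr_Yc sqr_M_rho.
set g0 := \big[Num.max/_]_(i < s) _.
set c := \sum_(i < s) (8 * enorm (pgrad F i 0) ^+ 2 + 2 * lam i ^+ 2).
have L2' := L1D (L1_sqr_enorm Lx) (L1_sqr_enorm Lxn).
have L3' := L1Z (8 * L ^+ 2 * s%:R) L2'; have L4' := L1Z 4 (L1_sqr_enorm Le).
have L5' := L1D (L1D L3' L4') (L1_cst P c).
apply: le_trans (le_Ex (L1_sqr_enorm Lxa) (L1Z (alpha k ^+ 2) L5') _) _.
  move=> w; exact: (full_step_proj (ltW L_gt0) FL cX cr lam_ge0 rlam a0
    (fun i => run_update i w hk) (pa w)).
rewrite (ExZ _ L5') ler_pM2l ?exprn_gt0//.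
rewrite (ExD (L1D L3' L4') (L1_cst P c)) Ex_cst (ExD L3' L4') (ExZ _ L2').
rewrite (ExZ _ (L1_sqr_enorm Le)) (ExD (L1_sqr_enorm Lx) (L1_sqr_enorm Lxn)).
rewrite -!sqr_rms.
have h1 : rms (x k) ^+ 2 <= rho ^+ 2.
  by rewrite lerXn2r ?nnegrE ?rms_ge0//; exact: (x_L2 hk1).2.
have h2 : rms (x k.+1) ^+ 2 <= rho ^+ 2.
  by rewrite lerXn2r ?nnegrE ?rms_ge0//; exact: (x_L2 hkS).2.
have h3 : rms (err k) ^+ 2 <= s%:R * sig ^+ 2.
  rewrite -sqr_sqs -exprMn lerXn2r ?nnegrE ?rms_ge0 ?mulr_ge0 ?sqs_ge0 ?sig_ge0//.
  exact: (err_L2 hk).2.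
have h4 : c <= s%:R * (8 * g0) + 2 * \sum_(i < s) Lr i ^+ 2.
  rewrite /c big_split/= -!mulr_sumr lerD//.
    rewrite mulrCA ler_pM2l//.
    apply: (@le_trans _ _ (\sum_(i < s) g0)); last by rewrite sumr_const card_ord mulr_natl.
    by apply: ler_sum => i _; exact: (le_bigmax _ (fun i => enorm (pgrad F i 0) ^+ 2)).
  by rewrite ler_pM2l//; apply: ler_sum => i _; exact: sqr_lam.
have h5 : 8 * L ^+ 2 * s%:R * (rms (x k) ^+ 2 + rms (x k.+1) ^+ 2) <=
    8 * L ^+ 2 * s%:R * (2 * rho ^+ 2).
  have c0 : 0 <= 8 * L ^+ 2 * s%:R :> R by rewrite mulr_ge0// mulr_ge0// sqr_ge0.
  apply: (ler_wpM2l c0); rewrite mulr_natl mulr2n; exact: lerD h1 h2.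
exact: proj_radius_le.
Qed.

(** The left side collects the error terms of an iteration, with every distance replaced by its a
    priori bound. As 0 < 1 - L theta < 1, the division in D only enlarges it. *)
Lemma D_const_ge :
  (alpha k * sqs * sig) ^+ 2 + 4 * (alpha k * sqs * lmax) ^+ 2 +
  alpha k ^+ 2 * A * sqs * rad + (alpha k * L * sqs) * rad * (alpha k * Yc) <=
  alpha k ^+ 2 * D.
Proof.
rewrite !exprMn sqr_sqs /D /D_const -/lmax -/rad -/sqs -/Yc.
set D1 := s%:R * (sig ^+ 2 + 4 * lmax ^+ 2).
have D10 : 0 <= D1 by rewrite mulr_ge0// addr_ge0 ?(sqr_ge0, mulr_ge0).
have Lt : L * theta < 1 by rewrite mulrC -ltr_pdivlMr// div1r.
have Lt0 : 0 < L * theta by rewrite mulr_gt0.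
have : D1 <= D1 / (1 - L * theta).
  by rewrite ler_pdivlMr ?subr_gt0// mulrBr mulr1 lerBlDr lerDl mulr_ge0// ltW.
have a2 : 0 < alpha k ^+ 2 by rewrite exprn_gt0.
rewrite -(ler_pM2l a2) => h.
by move: h; rewrite /D1; lra.
Qed.

(** Relates the radius alpha_k Yc to the bound 2 rho on a move, for the steps where the move may
    exceed that radius. *)
Lemma M_rho_ge :
  16 * (alpha k * L * sqs) ^+ 2 * rho ^+ 2 + 4 * (alpha k * sqs * sig) ^+ 2 <=
  (alpha k * Yc) ^+ 2.
Proof.
rewrite !exprMn sqr_sqs sqr_Yc sqr_M_rho.
have g0 : 0 <= \big[Num.max/0]_(i < s) enorm (pgrad F i 0) ^+ 2.
  exact: bigmax_ge_id.
have l0 : 0 <= \sum_(i < s) Lr i ^+ 2 by apply: sumr_ge0 => i _; exact: sqr_ge0.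
have : 0 <= alpha k ^+ 2 * (s%:R * (8 * \big[Num.max/0]_(i < s) enorm (pgrad F i 0) ^+ 2) +
    2 * \sum_(i < s) Lr i ^+ 2).
  by rewrite mulr_ge0 ?sqr_ge0// addr_ge0 ?mulr_ge0.
lra.
Qed.

End OneStep.

Lemma scale_ge0 k : (1 <= k <= K)%N -> [/\ 0 <= alpha k ^+ 2 * A * sqs,
  0 <= alpha k * L * sqs, 0 <= alpha k * sqs * sig & 0 <= alpha k * Yc].
Proof.
move=> /alpha_gt0/ltW al0; split.
- by rewrite mulr_ge0 ?sqs_ge0// mulr_ge0 ?A_ge0 ?sqr_ge0.
- by rewrite mulr_ge0 ?sqs_ge0// mulr_ge0// ltW.
- by rewrite mulr_ge0 ?sig_ge0// mulr_ge0 ?sqs_ge0.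
- by rewrite mulr_ge0// sqrtr_ge0.
Qed.

Lemma Ex_step_feasible k kap : (2 <= k <= K)%N -> 1 <= kap ->
  Ex (step_majorant k 0) <= (dist k ^+ 2 - dist k.+1 ^+ 2) / 2 +
    kap * (alpha k ^+ 2 * D) - (1 - kap^-1) / 2 * move_size k ^+ 2.
Proof.
case: k => // k /andP[k1 kK] kap1.
have hk : (1 <= k.+1 <= K)%N by rewrite kK.
have hk1 : (1 <= k.+1 <= K.+1)%N by apply/andP; split => //; exact: leqW.
have hk2 : (1 <= k.+2 <= K.+1)%N by [].
have Lx := (x_L2 hk1).1.
have [c1 c2 _ _] := scale_ge0 hk.
have bY : move_size k.+1 <= alpha k.+1 * Yc.
  apply: (rms_sub_proj_le hk Lx) => w i; apply: is_proj_self.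
  by apply: (run_feasible (k := k)); apply/andP; split=> //; exact: ltnW.
apply: (feasible_step_bound kap1 (rms_ge0 P _) bY (rms_ge0 P _) (dist_le hk2)
  (dist_le hk1) c2 c1 (D_const_ge hk)).
have := Ex_step_majorant_le hk 0 Lx (fun j => x_adapted j hk1).
have -> : rms (fun w => x k.+2 w - ((1 - 0) *: x k.+1 w + 0 *: xstar)) =
    move_size k.+1.
  by congr rms; apply/funext => w; rewrite subr0 scale1r scale0r addr0.
exact.
Qed.

Lemma run_x1 w : x 1%N w = x1.
Proof. by have [-> _ _] := run. Qed.

(** The splitting vector is the projection of x^1, a constant and so known before any batch. It is
    no farther than x^1 from the feasible points [xstar] and x^2. *)
Lemma Ex_step_first kap e : 1 <= kap ->
  0 <= e -> (17 / 5 * rho < rad -> rad * rho / 4 <= e) ->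
  Ex (step_majorant 1 0) <= (dist 1 ^+ 2 - dist 2 ^+ 2) / 2 +
    kap * (alpha 1%N ^+ 2 * D) - (1 - kap^-1) / 2 * move_size 1 ^+ 2 + e.
Proof.
move=> kap1 e0 re.
have hk : (1 <= 1 <= K)%N by rewrite K_gt0.
have hk1 : (1 <= 1 <= K.+1)%N by [].
have hk2 : (1 <= 2 <= K.+1)%N by rewrite ltnS.
have [Xstar _] := xstar_min.
have ex i : exists b, is_proj (@X i) (submxrow x1 i) b.
  by apply: is_proj_exists; [exact: cX|exists (submxrow xstar i); exact: Xstar].
pose a : T -> point := fun=> \mxrow_i sval (cid (ex i)).
have pa w i : is_proj (@X i) (submxrow (x 1%N w) i) (submxrow (a w) i).
  by rewrite run_x1 mxrowK; exact: svalP (cid (ex i)).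
have La : L2v a := L2v_cst P _.
have [Lx1 Lx2] := ((x_L2 hk1).1, (x_L2 hk2).1).
have [c1 c2 c3 c4] := scale_ge0 hk.
have bY := rms_sub_proj_le hk La pa.
have bd : rms (fun w => x 2 w - a w) <= move_size 1.
  apply: le_rms; [exact/L1_sqr_enorm/L2vB|exact: L2vB|move=> w].
  apply: enorm_blocks_le => i; rewrite !submxrowB.
  exact: is_proj_enormBl (pa w i) (run_feasible w hk i).
have wr : rms (fun w => a w - xstar) <= rad.
  have Lc := L2v_cst P xstar.
  apply: le_trans (dist_le hk1).
  apply: le_rms; [exact/L1_sqr_enorm/L2vB|exact: L2vB|move=> w].
  rewrite enormBC (enormBC (x 1 w)); apply: enorm_blocks_le => i.
  by rewrite !submxrowB; exact: is_proj_enormBl (pa w i) (Xstar i).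
apply: (infeasible_step_bound kap1 (rms_ge0 P _) bd bY (move_size_le hk) rho_ge0 c3
  (rms_ge0 P _) (dist_le hk2) wr c2 c1 (M_rho_ge 1) e0 re (D_const_ge hk)).
have := Ex_step_majorant_le hk 0 La (fun j => measurable_cst _).
have -> : rms (fun w => x 2 w - ((1 - 0) *: x 1 w + 0 *: xstar)) = move_size 1.
  by congr rms; apply/funext => w; rewrite subr0 scale1r scale0r addr0.
exact.
Qed.

(** The midpoint serves both as splitting vector and as reference point for the regularizers. Its
    distance to x^2 comes from Stewart's theorem rather than from the proximal step, so no
    projection occurs. *)
Lemma Ex_step_midpoint :
  Ex (step_majorant 1 2^-1) <= 7 / 10 * (alpha 1%N ^+ 2 * D + dist 1 ^+ 2 / 2).
Proof.
have hk : (1 <= 1 <= K)%N by rewrite K_gt0.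
have hk1 : (1 <= 1 <= K.+1)%N by [].
have hk2 : (1 <= 2 <= K.+1)%N by rewrite ltnS.
have [c1 c2 c3 c4] := scale_ge0 hk.
have [Lx1 Lx2 Lc] := (And3 (x_L2 hk1).1 (x_L2 hk2).1 (L2v_cst P xstar)).
pose a w := (1 - 2^-1) *: x 1%N w + 2^-1 *: xstar.
have La : L2v a by apply: L2vD; exact: L2vZ.
have aE w : a w - xstar = 2^-1 *: (x 1%N w - xstar).
  by apply/rowP => j; rewrite !mxE; field.
have hE : rms (fun w => x 2 w - a w) ^+ 2 =
    (dist 2 ^+ 2 + move_size 1 ^+ 2) / 2 - dist 1 ^+ 2 / 4.
  have [L1' L2' L3'] := And3 (L1_sqr_enorm (L2vB Lx1 Lc))
    (L1_sqr_enorm (L2vB Lx2 Lc)) (L1_sqr_enorm (L2vB Lx2 Lx1)).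
  have [M1 M2 M3] := And3 (L1Z (- 4^-1) L1') (L1Z 2^-1 L2') (L1Z 2^-1 L3').
  apply: midpoint_sqr (sqr_rms P _) (sqr_rms P _) (sqr_rms P _).
  rewrite -(ExZ _ L1') -(ExZ _ L2') -(ExZ _ L3') -(ExD M2 M3).
  rewrite -(ExD (L1D M2 M3) M1) sqr_rms; apply: eq_Rintegral => w _.
  by rewrite /a sqr_enorm_conv; field.
apply: (midpoint_step_bound (rms_ge0 P _) (rms_ge0 P _) c2 c1 rho_ge0 c4 hE
  (move_size_le hk) (dist_le hk2) (dist_le hk1) (M_rho_ge 1) (D_const_ge hk)).
have ma j : measurable_fun [set: g_sigma_algebraType (batch_events m xi 0)]
    ((fun w => a w 0 j) : g_sigma_algebraType (batch_events m xi 0) -> R).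
  by under eq_fun do rewrite /a run_x1; exact: measurable_cst.
have := Ex_step_majorant_le hk 2^-1 La ma.
have -> : rms (fun w => a w - xstar) = dist 1 / 2.
  rewrite (_ : (fun w => a w - xstar) = (fun w => 2^-1 *: (x 1%N w - xstar))).
    by rewrite [RHS]mulrC; apply: rmsZ; rewrite ?invr_ge0//; exact: L2vB.
  by apply/funext => w; exact: aE.
exact.
Qed.


Local Notation asum := (\sum_(1 <= k < K.+1) alpha k).

Lemma alpha_sum_gt0 : 0 < asum.
Proof.
rewrite big_add1 big_mkord (bigD1 (Ordinal K_gt0))//=.
rewrite ltr_pwDl//; first by apply: alpha_gt0; rewrite K_gt0.
by apply: sumr_ge0 => k _; apply/ltW/alpha_gt0; rewrite ltn_ord.
Qed.

Lemma weighted_avg_le w : feasible X (weighted_avg alpha x K w) /\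
  Phi (weighted_avg alpha x K w) <=
  asum^-1 * \sum_(1 <= k < K.+1) alpha k * Phi (x k.+1 w).
Proof.
have [_ Fle] := @convex_avg R _ setT F alpha (fun k => x k.+1 w) K
  (fun u v t _ _ t0 t1 => conj I (convex_functionE u v cF t0 t1)) K_gt0 alpha_gt0
  (fun _ _ => I).
have rle i := @convex_avg R _ (@X i) (@r i) alpha (fun k => submxrow (x k.+1 w) i) K
  (fun u v t Xu Xv t0 t1 => conj (convex_setE (@cX i) Xu Xv t0 t1)
    (convex_functionE u v (@cr i) t0 t1)) K_gt0 alpha_gt0
  (fun k hk => run_feasible w hk i).
have avgE i : submxrow (weighted_avg alpha x K w) i =
    asum^-1 *: \sum_(1 <= k < K.+1) alpha k *: submxrow (x k.+1 w) i.
  apply/rowP => j; rewrite !mxE !summxE; congr (_ * _).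
  by apply: eq_bigr => k _; rewrite !mxE.
split; first by move=> i; rewrite avgE; exact: (rle i).1.
have -> : \sum_(1 <= k < K.+1) alpha k * Phi (x k.+1 w) =
    \sum_(1 <= k < K.+1) alpha k * F (x k.+1 w) +
    \sum_(i < s) \sum_(1 <= k < K.+1) alpha k * @r i (submxrow (x k.+1 w) i).
  rewrite exchange_big -big_split/=; apply: eq_bigr => k _.
  by rewrite /composite mulrDr mulr_sumr.
rewrite /composite mulrDr; apply: lerD; first exact: Fle.
rewrite mulr_sumr; apply: ler_sum => i _.
by rewrite avgE; exact: (rle i).2.
Qed.

(** The averaged iterate is feasible, so the gap is nonnegative and [le_expectation] applies to it
    without measurability. *)
Lemma expectation_avg_le (t : nat -> R) : (forall k, 0 <= t k <= 1) ->
  ('E_P[fun w => (Phi (weighted_avg alpha x K w) - Phi xstar)%R] <=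
   (asum^-1 * \sum_(1 <= k < K.+1) Ex (step_majorant k (t k)))%:E)%E.
Proof.
move=> t01; have S0 := alpha_sum_gt0.
pose g w := asum^-1 * \sum_(1 <= k < K.+1) step_majorant k (t k) w.
have Lk (k : 'I_K) : L1 (step_majorant k.+1 (t k.+1)).
  by apply: L1_step_majorant; rewrite ltn_ord.
have Ls : L1 (fun w => \sum_(1 <= k < K.+1) step_majorant k (t k) w).
  under eq_fun do rewrite big_add1 big_mkord; exact: L1_sum.
have -> : asum^-1 * \sum_(1 <= k < K.+1) Ex (step_majorant k (t k)) = Ex g.
  rewrite /g (ExZ _ Ls); congr (_ * _); rewrite big_add1 big_mkord -Ex_sum//.
  by apply: eq_Rintegral => w _; rewrite big_add1 big_mkord.
apply: le_expectation => [w|w|]; last exact: L1Z.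
  by rewrite subr_ge0; exact: (xstar_min.2 _ (weighted_avg_le w).1).
apply: le_trans (lerB (weighted_avg_le w).2 (lexx _)) _.
have -> : Phi xstar = asum^-1 * \sum_(1 <= k < K.+1) alpha k * Phi xstar.
  by rewrite -mulr_suml mulrA mulVf ?mul1r// gt_eqF.
rewrite -mulrBr /g ler_pM2l ?invr_gt0// -sumrB.
rewrite big_nat_cond [leRHS]big_nat_cond; apply: ler_sum => k /andP[hk _].
have /andP[t0 t1] := t01 k; rewrite -mulrBr.
exact: le_step_majorant.
Qed.

Lemma D_const_ge0 : 0 <= D.
Proof.
have K1 : (1 <= 1 <= K)%N by rewrite K_gt0.
have a2 : 0 < alpha 1%N ^+ 2 by rewrite exprn_gt0// alpha_gt0.
have [c1 c2 _ c4] := scale_ge0 K1.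
rewrite -(pmulr_rge0 _ a2); apply: le_trans (D_const_ge K1).
rewrite !addr_ge0 ?sqr_ge0//; first by rewrite mulr_ge0// sqr_ge0.
  by rewrite mulr_ge0// rad_ge0.
by rewrite mulr_ge0// mulr_ge0// rad_ge0.
Qed.

Lemma dist1E : dist 1 = enorm (xstar - x1).
Proof.
rewrite enormBC -(rms_cst P); congr rms.
by apply/funext => w; rewrite run_x1.
Qed.

(** The reverse triangle inequality gives |xstar| - rho. When rad is large against rho, no iterate
    is near [xstar], and this pays for the excess. *)
Lemma dist_ge j : (1 <= j <= K.+1)%N -> rad - 2 * rho <= dist j.
Proof.
move=> hj; have [Lj xr] := x_L2 hj.
have := rmsB Lj (L2vB Lj (L2v_cst P xstar)).
rewrite -/(dist j) (_ : (fun w => _) = fun=> xstar); last first.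
  by apply/funext => w; rewrite subKr.
rewrite rms_cst => h.
have -> : rad - 2 * rho = enorm xstar - rho by rewrite /rad; ring.
by rewrite lerBlDl (le_trans h)// lerD2r.
Qed.

Let excess := if 17 / 5 * rho < rad then rad * rho / 4 else 0.

Lemma excess_ge0 : 0 <= excess.
Proof.
by rewrite /excess; case: ifP => // _; rewrite divr_ge0// mulr_ge0// rad_ge0.
Qed.

Lemma excess_dist : excess <= dist K.+1 ^+ 2 / 2.
Proof.
rewrite /excess; case: ifP => [h|_]; last by rewrite divr_ge0// sqr_ge0.
by apply: excess_le => //; apply: dist_ge; rewrite leqnn.
Qed.

Lemma run_sum_le kap : 1 <= kap ->
  \sum_(1 <= k < K.+1) Ex (step_majorant k 0) <=
  (dist 1 ^+ 2 - dist K.+1 ^+ 2) / 2 +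
  kap * \sum_(1 <= k < K.+1) alpha k ^+ 2 * D -
  (1 - kap^-1) / 2 * \sum_(1 <= k < K.+1) move_size k ^+ 2 + excess.
Proof.
move=> kap1; apply: (@telescope_le _ (fun k => Ex (step_majorant k 0))
  (fun k => dist k ^+ 2) (fun k => alpha k ^+ 2 * D) (fun k => move_size k ^+ 2)) => //.
  by apply: Ex_step_first => //; [exact: excess_ge0|rewrite /excess => ->].
by move=> k hk; exact: Ex_step_feasible.
Qed.

Lemma run_bound :
  ('E_P[fun w => (Phi (weighted_avg alpha x K w) - Phi xstar)%R] <=
   (asum^-1 * (enorm (xstar - x1) ^+ 2 / 2 +
     D * \sum_(1 <= k < K.+1) alpha k ^+ 2))%:E)%E.
Proof.
apply: le_trans (expectation_avg_le (t := fun=> 0) _) _ => [k|].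
  by rewrite lexx ler01.
rewrite lee_fin ler_pM2l ?invr_gt0 ?alpha_sum_gt0// -dist1E (mulrC D) mulr_suml.
exact: one_factor_close (run_sum_le (lexx 1)) excess_dist.
Qed.

Lemma run_bound1 : K = 1%N ->
  ('E_P[fun w => (Phi (weighted_avg alpha x K w) - Phi xstar)%R] <=
   ((alpha 1%N)^-1 * (7 / 10 * (alpha 1%N ^+ 2 * D +
     enorm (xstar - x1) ^+ 2 / 2)))%:E)%E.
Proof.
move=> K1; apply: le_trans (expectation_avg_le (t := fun=> 2^-1) _) _ => [k|].
  by rewrite invr_ge0 ler0n invf_le1// ler1n.
rewrite lee_fin K1 !big_nat1 -dist1E ler_pM2l; first exact: Ex_step_midpoint.
by rewrite invr_gt0 alpha_gt0// K1.
Qed.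

Lemma run_bound2 : K = 2%N ->
  ('E_P[fun w => (Phi (weighted_avg alpha x K w) - Phi xstar)%R] <=
   ((alpha 1%N + alpha 2%N)^-1 * (65 / 132 * enorm (xstar - x1) ^+ 2 +
     26 / 25 * (alpha 1%N ^+ 2 + alpha 2%N ^+ 2) * D))%:E)%E.
Proof.
move=> K2; apply: le_trans (expectation_avg_le (t := fun=> 0) _) _ => [k|].
  by rewrite lexx ler01.
have h3 : (1 <= 3 <= K.+1)%N by rewrite K2.
have h2 : (1 <= 2 <= K.+1)%N by rewrite K2.
have h1 : (1 <= 1 <= K.+1)%N by rewrite K2.
have := alpha_sum_gt0.
have kap1 : 1 <= 26 / 25 :> R by lra.
have := run_sum_le kap1; rewrite lee_fin -dist1E K2 !(@big_nat_recr _ _ _ 2)//= !big_nat1.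
move=> h a0; rewrite ler_pM2l ?invr_gt0//.
have q3 : dist 1 <= dist 3 + move_size 1 + move_size 2.
  have Lc := L2v_cst P xstar.
  have [Lx1 Lx2 Lx3] := And3 (x_L2 h1).1 (x_L2 h2).1 (x_L2 h3).1.
  have -> : dist 1 = rms (fun w => ((x 3%N w - xstar) - (x 2%N w - x 1%N w)) -
      (x 3%N w - x 2%N w)).
    by congr rms; apply/funext => w; apply/rowP => j; rewrite !mxE; ring.
  apply: le_trans (rmsB (L2vB (L2vB Lx3 Lc) (L2vB Lx2 Lx1)) (L2vB Lx3 Lx2)) _.
  by rewrite lerD2r; exact: rmsB (L2vB Lx3 Lc) (L2vB Lx2 Lx1).
exact: two_step_close rho_ge0 (rms_ge0 P _) (dist_le h1) q3 (dist_ge h3) (erefl _) h.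
Qed.

End Run.

Theorem theorem1 (R : realType) (d d' : measure_display)
    (T : measurableType d) (S : measurableType d') (P : probability T R)
    (s : nat) (n : 'I_s -> nat)
    (f : 'rV[R]_(\sum_(i < s) n i) -> S -> R) (xi0 : {RV P >-> S})
    (r : forall i : 'I_s, 'rV[R]_(n i) -> R)
    (X : forall i : 'I_s, set 'rV[R]_(n i))
    (m : nat -> nat) (xi : nat -> nat -> {RV P >-> S})
    (L theta A rho : R) (sigma : nat -> R) (Lr : 'I_s -> R)
    (x1 xstar : 'rV[R]_(\sum_(i < s) n i))
    (F := exp_obj P f xi0) (Phi := composite F r) :
  (0 < s)%N ->
  (forall i, convex_set (X i)) ->
  (forall x, P.-integrable [set: T] (EFin \o (fun w => f x (xi0 w)))) ->
  (forall z x, differentiable (f ^~ z) x) ->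
  cont_differentiable F ->
  (forall k, (0 < m k)%N) ->
  (forall k l B, (l < m k)%N -> measurable B ->
     distribution P (xi k l) B = distribution P xi0 B) ->
  0 < theta -> 0 < L -> theta < L^-1 ->
  (forall k, 0 <= sigma k) -> 0 <= rho ->
  has_lbound [set Phi x | x in feasible X] ->
  (forall i x y, enorm (pgrad F i x - pgrad F i y) <= L * enorm (x - y)) ->
  (forall i u v, `|r i u - r i v| <= Lr i * enorm (u - v)) ->
  convex_function setT F ->
  (forall i, convex_function setT (r i)) ->
  is_argmin (feasible X) Phi xstar ->
  (* stepsizes theta / sqrt k *)
  (forall x : nat -> T -> 'rV[R]_(\sum_(i < s) n i),
     let alpha (k : nat) : R := theta / Num.sqrt k%:R in
     let iters := [set k : nat | (1 <= k)%N] in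
     let sup_sigma := sup [set sigma k | k in iters] in
     let D := D_const F L theta A rho sup_sigma Lr xstar in
     bsg_run f r X m xi iters (fun=> alpha) x x1 ->
     grad_error_bound f xi0 m xi iters (fun=> alpha) x A sigma ->
     iterates_bound P iters x rho ->
     has_ubound [set sigma k | k in iters] ->
     forall K : nat, (1 <= K)%N ->
       ('E_P[fun w => (Phi (weighted_avg alpha x K w) - Phi xstar)%R] <=
        (D * theta * ((1 + ln K%:R) / Num.sqrt (1 + K%:R)) +
         enorm (xstar - x1) ^+ 2 / (2 * theta * Num.sqrt (1 + K%:R)))%:E)%E) /\
  (* predetermined number K of iterations, stepsizes theta / sqrt K *)
  (forall (K : nat) (x : nat -> T -> 'rV[R]_(\sum_(i < s) n i)),
     (1 <= K)%N ->
     let alpha (k : nat) : R := theta / Num.sqrt K%:R in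
     let iters := [set k : nat | (1 <= k <= K)%N] in
     let sup_sigma := sup [set sigma k | k in iters] in
     let D := D_const F L theta A rho sup_sigma Lr xstar in
     bsg_run f r X m xi iters (fun=> alpha) x x1 ->
     grad_error_bound f xi0 m xi iters (fun=> alpha) x A sigma ->
     iterates_bound P iters x rho ->
     ('E_P[fun w => (Phi (weighted_avg alpha x K w) - Phi xstar)%R] <=
      (D * theta / Num.sqrt K%:R +
       enorm (xstar - x1) ^+ 2 / (2 * theta * Num.sqrt K%:R))%:E)%E).
Proof.
move=> s0 cX _ _ [dF _] _ _ t0 L0 tL sg0 rho0 _ FL rL cF cr xmin; split.
  move=> x alpha iters sup_sigma D hrun hnoise hbound hub K K_gt0.
  have itersK k : (1 <= k <= K)%N -> iters k by case/andP.
  have al0 k : (1 <= k <= K)%N -> 0 < alpha k.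
    by case/andP=> k1 _; rewrite divr_gt0// sqrtr_gt0 ltr0n.
  have sgle k : (1 <= k <= K)%N -> sigma k <= sup_sigma.
    by move=> hk; apply: ub_le_sup => //; exists k => //; exact: itersK.
  have D0 : 0 <= D.
    exact: (D_const_ge0 Lr xstar s0 t0 L0 tL rho0 hnoise itersK al0 sg0 sgle K_gt0).
  have rb := run_bound s0 cX dF t0 L0 tL rho0 FL rL cF cr xmin hrun hnoise hbound
    itersK al0 sg0 sgle K_gt0.
  have rb1 := run_bound1 s0 cX dF t0 L0 tL rho0 FL rL cF cr xmin hrun hnoise hbound
    itersK al0 sg0 sgle K_gt0.
  have rb2 := run_bound2 s0 cX dF t0 L0 tL rho0 FL rL cF cr xmin hrun hnoise hbound
    itersK al0 sg0 sgle K_gt0.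
  have [K3|] := leqP 3 K.
    apply: le_trans rb _; rewrite lee_fin; exact: final_bound3.
  rewrite ltnS leq_eqVlt => /orP[/eqP K2|].
    apply: le_trans (rb2 K2) _; rewrite lee_fin K2 /alpha sqrtr1 divr1.
    have -> : (theta / Num.sqrt 2%:R) ^+ 2 = theta ^+ 2 / 2.
      by rewrite exprMn exprVn sqr_sqrtr.
    exact: final_bound2.
  rewrite ltnS leq_eqVlt ltnNge K_gt0 orbF => /eqP K1.
  apply: le_trans (rb1 K1) _; rewrite lee_fin K1 /alpha sqrtr1 divr1.
  exact: final_bound1.
move=> K x K_gt0 alpha iters sup_sigma D hrun hnoise hbound.
have Kp : 0 < K%:R :> R by rewrite ltr0n.
have itersK k : (1 <= k <= K)%N -> iters k by [].
have al0 k : (1 <= k <= K)%N -> 0 < alpha k by rewrite divr_gt0// sqrtr_gt0.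
(* Only finitely many indices occur, so the sum of the nonnegative sigma_k is an upper bound. *)
have hub : has_ubound [set sigma k | k in iters].
  exists (\sum_(i < K.+1) sigma i) => _ [k /= /andP[_ kK] <-].
  rewrite (bigD1 (Ordinal (kK : (k < K.+1)%N)))//= lerDl.
  by apply: sumr_ge0.
have sgle k : (1 <= k <= K)%N -> sigma k <= sup_sigma.
  by move=> hk; apply: ub_le_sup => //; exists k.
have rb := run_bound s0 cX dF t0 L0 tL rho0 FL rL cF cr xmin hrun hnoise hbound
  itersK al0 sg0 sgle K_gt0.
(* For constant steps the sums are exactly theta sqrt K and theta^2, and the two bounds coincide for
   every K >= 1. *)
apply: le_trans rb _; rewrite lee_fin /alpha !sumr_const_nat subSS subn0.
set b : R := Num.sqrt K%:R; have b0 : 0 < b by rewrite sqrtr_gt0.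
rewrite -(mulr_natl (theta / b)) -(mulr_natl ((theta / b) ^+ 2)) -/D.
have -> : K%:R = b ^+ 2 by rewrite sqr_sqrtr.
by rewrite le_eqVlt; apply/orP; left; apply/eqP; field; rewrite !gt_eqF.
Qed.
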